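(* Let $\mathcal X: y^2+h(x)y=f(x)$ be a hyperelliptic curve of genus $g\ge2$ over $\mathbb F_q$ with unique point at infinity $P_\infty$ and hyperelliptic involution $\iota$. Let $t\ge g$, let $(u_A,v_A)$ be a reduced Mumford pair with $\deg u_A=g$, and let $(u_B,v_B)$ be a (semi-reduced) Mumford pair with $\deg u_B=t$. Assume $\gcd(u_A,u_B)=1$ and $\gcd(u_B,2v_B+h)=1$. Let $v_G,v_H$ be the polynomials modulo $u_Au_B$ (of degree $<g+t$) determined by \[ v_G\equiv v_A \pmod{u_A},\quad v_G\equiv v_B\pmod{u_B},\qquad v_H\equiv v_A\pmod{u_A},\quad v_H\equiv -v_B-h\pmod{u_B}, \] and set $G:=D_{(u_Au_B,v_G)}-P_\infty$, $H:=D_{(u_Au_B,v_H)}-P_\infty$. Let $\mathcal D=\sum_{i=1}^t(P_i+\iota(P_i))$ be a divisor supported on $2t$ distinct $\mathbb F_q$-rational points, disjoint from $\operatorname{Supp}(G)\cup\operatorname{Supp}(H)$. Assume also that $u_Au_B$ is coprime to the polynomial $\prod_{i=1}^t (x-x(P_i))$ vanishing on the $x$-coordinates of $\operatorname{Supp}(\mathcal D)$. Then the algebraic geometry codes $\mathcal C_{\mathcal L}(\mathcal D,G)$ and $\mathcal C_{\mathcal L}(\mathcal D,H)$ form a linear complementary pair of length $2t$, each of dimension $t$. Moreover, the minimum distance of each code satisfies $d\ge t-g+1$.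
   Context: $\mathbb F_q$ is a finite field, of any characteristic. $\mathcal X$ is the smooth projective curve of genus $g\ge2$ with affine equation $y^2+h(x)y=f(x)$, where $h,f\in\mathbb F_q[x]$, $f$ is monic of degree $2g+1$, $\deg h\le g$, and the affine curve is nonsingular over $\overline{\mathbb F}_q$; it has a single point at infinity $P_\infty$, which is $\mathbb F_q$-rational. The hyperelliptic involution is $\iota(x,y)=(x,-y-h(x))$, $\iota(P_\infty)=P_\infty$. A Mumford pair is $(u,v)\in\mathbb F_q[x]^2$ with $u$ monic, $\deg v<\deg u$ ($v=0$ if $u=1$), and $u\mid v^2+hv-f$; such pairs are also called semi-reduced, and a pair is reduced if $\deg u\le g$. It determines the effective affine $\mathbb F_q$-rational divisor $D_{(u,v)}=\sum_{\xi}m_\xi\,(\xi,v(\xi))$, where $\xi$ runs over the roots of $u$ in $\overline{\mathbb F}_q$ and $m_\xi$ is the multiplicity of $\xi$ in $u$; its degree is $\deg u$. For a divisor $\mathcal D=R_1+\dots+R_n$ with $R_i$ distinct $\mathbb F_q$-rational points and a divisor $G$ with $\operatorname{Supp}(G)\cap\operatorname{Supp}(\mathcal D)=\emptyset$, the AG code is $\mathcal C_{\mathcal L}(\mathcal D,G)=\{(z(R_1),\dots,z(R_n)) : z\in\mathcal L(G)\}\subseteq\mathbb F_q^n$, where $\mathcal L(G)$ is the Riemann-Roch space. Two linear codes $\mathcal C_1,\mathcal C_2\subseteq\mathbb F_q^n$ form a linear complementary pair (LCP) if $\mathcal C_1\oplus\mathcal C_2=\mathbb F_q^n$. *)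

(* Defs.v *)
From HB Require Import structures.
From mathcomp Require Import all_boot all_order all_algebra all_field.
From mathcomp.multinomials Require Import freeg.
From mathcomp Require Import zify ring.

Set Implicit Arguments.
Unset Strict Implicit.
Unset Printing Implicit Defensive.

Import GRing.Theory.
Local Open Scope ring_scope.

(* The affine equation y^2 + h(x) y = f(x). *)
Record hyperelliptic (K : fieldType) (g : nat) := Hyperelliptic {
  hpol : {poly K};
  fpol : {poly K};
  fpol_monic : fpol \is monic;
  size_fpol : size fpol = (2 * g + 1).+1;
  size_hpol : (size hpol <= g.+1)%N
}.

Section BaseChange.
Variables (F K : fieldType) (g : nat) (phi : {rmorphism F -> K}).
Variable C : hyperelliptic F g.

Fact base_change_monic : map_poly phi (fpol C) \is monic.
Proof. by rewrite map_monic fpol_monic. Qed.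

Fact base_change_size_f : size (map_poly phi (fpol C)) = (2 * g + 1).+1.
Proof. by rewrite size_map_poly size_fpol. Qed.

Fact base_change_size_h : (size (map_poly phi (hpol C)) <= g.+1)%N.
Proof. by rewrite size_map_poly size_hpol. Qed.

Definition base_change : hyperelliptic K g :=
  Hyperelliptic base_change_monic base_change_size_f base_change_size_h.
End BaseChange.

(* [Some (a, b)] is the affine point (a, b) and [None] is the point at
   infinity; membership in the curve is the separate predicate [on_curve]. *)
Definition point (K : Type) := option (K * K).
HB.instance Definition _ (K : choiceType) := Choice.on (point K).

Definition Pinf {K : Type} : point K := None.

Definition map_point (F K : Type) (phi : F -> K) (P : point F) : point K :=
  omap (fun p => (phi p.1, phi p.2)) P.

(* The value 0 at infinity is a junk value. *)
Definition xcoord (K : fieldType) (P : point K) : K :=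
  if P is Some p then p.1 else 0.

Fact clear_denominator (L : fieldType) (a b n d : L) : d != 0 ->
  n * n + a * n * d - b * (d * d) = ((n / d) ^+ 2 + a * (n / d) - b) * d ^+ 2.
Proof. by move=> d0; field. Qed.

Fact size_sqr (L : fieldType) (p : {poly L}) :
  p != 0 -> size (p ^+ 2) = (2 * (size p).-1).+1.
Proof.
move=> p0; rewrite mulnC -[LHS]prednK; first by congr _.+1; exact: size_exp.
by rewrite size_poly_gt0 expf_neq0.
Qed.

Section Curve.
Variables (K : fieldType) (g : nat) (C : hyperelliptic K g).
Local Notation h := (hpol C).
Local Notation f := (fpol C).

Definition on_curve (P : point K) : bool :=
  if P is Some (a, b) then b ^+ 2 + h.[a] * b == f.[a] else true.

Definition involution (P : point K) : point K :=
  if P is Some (a, b) then Some (a, - b - h.[a]) else Pinf.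

(* No affine K-point is a common zero of both partial derivatives. *)
Definition affine_nonsingular : Prop :=
  forall a b : K, on_curve (Some (a, b)) ->
    ~ (b *+ 2 + h.[a] = 0 /\ h^`().[a] * b - f^`().[a] = 0).

(* y^2 + h y - f as a polynomial in y over K(x) *)
Definition curve_poly : {poly {fraction {poly K}}} :=
  'X^2 + (FracField.tofrac h)%:P * 'X - (FracField.tofrac f)%:P.

Fact size_curve_poly_tail :
  (size ((FracField.tofrac h)%:P * 'X - (FracField.tofrac f)%:P)%R <= 2)%N.
Proof.
apply: (leq_trans (size_polyD _ _)).
rewrite geq_max size_polyN (leq_trans (size_polyC_leq1 _)) // andbT.
apply: (leq_trans (size_polyMleq _ _)); rewrite size_polyX addn2 /= ltnS.
exact: size_polyC_leq1.
Qed.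

Fact size_curve_poly : size curve_poly = 3.
Proof.
rewrite /curve_poly -addrA size_polyDl ?size_polyXn //.
exact: size_curve_poly_tail.
Qed.

Fact curve_poly_monic : curve_poly \is monic.
Proof.
rewrite monicE /curve_poly -addrA lead_coefDl ?lead_coefXn //.
by rewrite size_polyXn ltnS size_curve_poly_tail.
Qed.

Fact fractionP (r : {fraction {poly K}}) :
  exists n d : {poly K},
    d != 0 /\ r = FracField.tofrac n / FracField.tofrac d.
Proof.
elim/quotW: r => x; exists (frac x).1, (frac x).2.
have d0 : (frac x).2 != 0 := denom_ratioP x.
split=> //; apply: (canRL (mulfK _)); first by rewrite tofrac_eq0.
rewrite -[X in _ * X]/(FracField.tofrac _) /=; unlock FracField.tofrac.
rewrite -[_ * _]/(FracField.mul _ _) -FracField.pi_mul; apply/eqmodP => /=.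
rewrite /equivf /FracField.equivf /FracField.mulf.
by rewrite !numden_Ratio ?mulf_neq0 ?oner_neq0 //= !mulr1 mulrC.
Qed.

Fact curve_poly_noroot (r : {fraction {poly K}}) : ~~ root curve_poly r.
Proof.
apply/negP=> /rootP; have [n [d [d0 ->]]] := fractionP r.
have dF : FracField.tofrac d != 0 by rewrite tofrac_eq0.
rewrite /curve_poly !(hornerD, hornerN, hornerM, hornerXn, hornerC, hornerX) => E.
have {E} E : n ^+ 2 + h * n * d = f * d ^+ 2.
  apply/eqP; rewrite -(tofrac_eq (_ + _)) tofracD !expr2 !tofracM.
  apply/eqP/subr0_eq; rewrite -[RHS](mul0r (FracField.tofrac d ^+ 2)) -{}E.
  exact: clear_denominator.
have f0 : f != 0 by rewrite monic_neq0 ?fpol_monic.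
have szR : size (f * d ^+ 2) = (2 * g + 2 * (size d).-1).+2.
  transitivity (size f + size (d ^+ 2)).-1; first by rewrite size_mul ?expf_neq0.
  by rewrite size_fpol size_sqr //; lia.
have sd : size d != 0 by rewrite size_poly_eq0.
have szM : (size (h * n * d)%R <= g + size n + size d - 1)%N.
  have := size_polyMleq h n; have := size_polyMleq (h * n) d.
  have := size_hpol C; lia.
have [le_n|gt_n] := leqP (size n) (g + size d).
  have := size_polyD (n ^+ 2) (h * n * d); rewrite E szR.
  have : (size (n ^+ 2)%R <= 2 * size n - 1)%N.
    by rewrite expr2; have := size_polyMleq n n; lia.
  lia.
have n0 : n != 0 by rewrite -size_poly_gt0; lia.
have szn := size_sqr n0.
have := size_polyDl (p := n ^+ 2) (q := h * n * d); rewrite E szR szn; lia.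
Qed.

Fact curve_poly_mi : monic_irreducible_poly curve_poly.
Proof.
split; last exact: curve_poly_monic.
by apply: cubic_irreducible curve_poly_noroot; rewrite size_curve_poly.
Qed.

(* K(x)[y] / (y^2 + h y - f), the function field K(X) of the curve over K *)
Definition funfield : fieldType := {poly %/ curve_poly with curve_poly_mi}.

Definition of_ratfun (r : {fraction {poly K}}) : funfield :=
  in_qpoly curve_poly r%:P.
Fact of_ratfun_zmod_morphism : zmod_morphism of_ratfun.
Proof. by move=> a b; rewrite /of_ratfun polyCB; exact: raddfB (in_qpoly _) _ _. Qed.
Fact of_ratfun_monoid_morphism : monoid_morphism of_ratfun.
Proof.
split; first exact: in_qpoly1.
by move=> a b; rewrite /of_ratfun polyCM in_qpolyM.
Qed.
HB.instance Definition _ :=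
  GRing.isZmodMorphism.Build _ _ of_ratfun of_ratfun_zmod_morphism.
HB.instance Definition _ :=
  GRing.isMonoidMorphism.Build _ _ of_ratfun of_ratfun_monoid_morphism.

Definition constF : K -> funfield :=
  of_ratfun \o @FracField.tofrac {poly K} \o polyC.
HB.instance Definition _ := GRing.RMorphism.on constF.

Definition xF : funfield := of_ratfun (FracField.tofrac 'X).
Definition yF : funfield := in_qpoly curve_poly 'X.

(* Two charts cover the smooth projective model: the affine one, with
   coordinates (x, y), and the one with coordinates w = 1/x, s = y/x^(g+1)
   and equation s^2 + w^(g+1) h(1/w) s = w^(2g+2) f(1/w), whose only point
   above w = 0 is (w, s) = (0, 0), the point at infinity. *)
Definition chart (P : point K) : funfield * funfield :=
  if P is Some _ then (xF, yF) else (xF^-1, yF / xF ^+ g.+1).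

Definition center (P : point K) : K * K := odflt (0, 0) P.

(* Bivariate polynomials have their first variable as the outer one. *)
Definition eval2F (p : {poly {poly K}}) (z : funfield * funfield) : funfield :=
  (map_poly (map_poly constF) p).[z.1, z.2].
Definition eval2 (p : {poly {poly K}}) (c : K * K) : K := p.[c.1, c.2].

(* z lies in the local ring at P and c is its residue there, i.e. z(P) = c. *)
Definition has_value (P : point K) (z : funfield) (c : K) : Prop :=
  exists p q : {poly {poly K}},
    [/\ eval2 q (center P) != 0,
        z = eval2F p (chart P) / eval2F q (chart P)
      & c = eval2 p (center P) / eval2 q (center P)].

Definition regular (P : point K) (z : funfield) : Prop :=
  exists c, has_value P z c.

(* t generates the maximal ideal of the local ring at P. *)
Definition uniformizer (P : point K) (t : funfield) : Prop :=
  [/\ t != 0, has_value P t 0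
    & forall s, has_value P s 0 -> regular P (s / t)].

(* ord_P(z) = n *)
Definition has_ord (P : point K) (z : funfield) (n : int) : Prop :=
  exists t u : funfield,
    [/\ uniformizer P t, exists2 c, c != 0 & has_value P u c & z = t ^ n * u].

End Curve.

Notation divisor K := {freeg (point K) / int}.

Section Rational.
Variables (F : fieldType) (K : closedFieldType) (phi : {rmorphism F -> K}).
Variables (g : nat) (C : hyperelliptic F g).
Local Notation h := (hpol C).
Local Notation f := (fpol C).
Local Notation CK := (base_change phi C).

Definition mumford (u v : {poly F}) : bool :=
  [&& u \is monic, (size v < size u)%N & u %| v ^+ 2 + h * v - f].

Definition reduced_mumford (u v : {poly F}) : bool :=
  mumford u v && (size u <= g.+1)%N.

Definition poly_roots (p : {poly K}) : seq K :=
  undup (sval (closed_field_poly_normal p)).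

(* D_(u,v), a divisor over the algebraic closure K *)
Definition mumford_divisor (u v : {poly F}) : divisor K :=
  \sum_(xi <- poly_roots (map_poly phi u))
    << (mup xi (map_poly phi u))%:Z *g
       (Some (xi, (map_poly phi v).[xi]) : point K) >>.

Definition point_divisor (P : point F) : divisor K := << map_point phi P >>.

(* The functions defined over F: quotients of polynomials in x and y with
   coefficients in F. *)
Definition rational (z : funfield CK) : Prop :=
  exists p q : {poly {poly F}},
    let ev r := eval2F (map_poly (map_poly phi) r) (xF CK, yF CK) in
    ev q != 0 /\ z = ev p / ev q.

(* Riemann-Roch space of an F-rational divisor, inside the field of
   F-rational functions *)
Definition RRspace (G : divisor K) (z : funfield CK) : Prop :=
  rational z /\
  (z = 0 \/ forall P, on_curve CK P ->
              exists2 n : int, has_ord P z n & 0 <= n + coeff P G).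

Definition AG_codeword n (R : 'I_n -> point F) (G : divisor K)
    (c : 'rV[F]_n) : Prop :=
  exists2 z, RRspace G z &
    forall i, has_value (map_point phi (R i)) z (phi (c 0 i)).

Definition is_AG_code n (R : 'I_n -> point F) (G : divisor K)
    (V : {vspace 'rV[F]_n}) : Prop :=
  forall c, c \in V <-> AG_codeword R G c.

End Rational.

Section Codes.
Variables (F : finFieldType) (n : nat).
Implicit Types V W : {vspace 'rV[F]_n}.

Definition hamming (c d : 'rV[F]_n) : nat := #|[set i | c 0 i != d 0 i]|.

(* The junk value for a zero code is n. *)
Definition min_dist V : nat :=
  \big[minn/n]_(p : 'rV[F]_n * 'rV[F]_n |
                 [&& p.1 \in V, p.2 \in V & p.1 != p.2]) hamming p.1 p.2.

Definition LCP V W : Prop := directv (V + W) /\ (V + W)%VS = fullv.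

End Codes.

(* Main.v *)
(* Write [u = uA * uB], so [deg u = g + t].  The function [u] has divisor
   [D_(u,v) + iota D_(u,v) - 2 (g + t) Pinf], hence [z] lies in [L(D_(u,v) - Pinf)]
   iff [u z = a + b y] for polynomials [a], [b] (the affine coordinate ring is
   integrally closed, by smoothness) with [u] dividing [a - b (v + h)] and, from
   the order at infinity, [deg a < g + t] and [deg b < t].  Thus [b] is arbitrary
   and [a = b (v + h) mod u], so the space has dimension [t] without Riemann-Roch.
   If [a + b y] vanishes on all evaluation points, then [b] vanishes at [t]
   distinct abscissas and is [0]: evaluation is injective.  The norm
   [a^2 - a b h - b^2 f] has degree less than [2 (g + t)] and is divisible by [u],
   which leaves at most [g + t - 1] zeros and gives the distance bound.  A common
   codeword has the same [b] for both codes, and the coprimality hypotheses force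
   [uB] to divide [b], so [b = 0]. *)

Require Import Defs.
From HB Require Import structures.
From mathcomp Require Import all_boot all_order all_algebra all_field.
From mathcomp.multinomials Require Import freeg.
From mathcomp Require Import zify ring.

Set Implicit Arguments.
Unset Strict Implicit.
Unset Printing Implicit Defensive.

Import Order.TTheory GRing.Theory Num.Theory.
Local Open Scope ring_scope.

(** * Local rings and orders *)

(** Local rings are given as sets of quotients with residues, so the existence of an order at every
    point has to be proved before any Riemann-Roch condition can be used. Both charts have the shape
    y^2 + h y = f, and one study of a smooth point (al, be) of such a chart covers them. Since
    characteristic 2 is allowed, the dichotomy is whether 2 be + h(al) vanishes, that is, whether
    the point is its own conjugate: if not, x - al is a uniformizer; if so, y - be is one and x - al
    has order 2. The point at infinity is of the second kind.

    The divisibility of a - b (v + h) by u is read at the conjugates of the points of D_(u,v): there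
    z has no pole and y - v is a unit, while a + b y and a - b (v + h) differ by b (y + v + h) = b u
    k / (y - v). Self-conjugate points escape this argument, but smoothness leaves u only simple
    roots there. *)

Section Place.
Variables (K L : fieldType) (V : L -> K -> Prop).

(* [V z c] stands for: [z] lies in the local ring of a point, with residue [c]. *)
Record place : Prop := Place {
  place_fun : forall z c d, V z c -> V z d -> c = d;
  place1 : V 1 1;
  placeB : forall z z' c c', V z c -> V z' c' -> V (z - z') (c - c');
  placeM : forall z z' c c', V z c -> V z' c' -> V (z * z') (c * c');
  placeV : forall z c, V z c -> c != 0 -> V z^-1 c^-1
}.

Definition pregular z := exists c, V z c.
Definition punit z := exists2 c, c != 0 & V z c.
Definition puniformizer t :=
  [/\ t != 0, V t 0 & forall s, V s 0 -> pregular (s / t)].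
Definition pord z (n : int) :=
  exists t u, [/\ puniformizer t, punit u & z = t ^ n * u].

Hypothesis HV : place.

Lemma place0 : V 0 0.
Proof. by rewrite -(subrr (1 : L)) -(subrr (1 : K)); apply: (placeB HV); apply: (place1 HV). Qed.

Lemma placeN z c : V z c -> V (- z) (- c).
Proof. by move=> h; rewrite -sub0r -(sub0r c); apply: (placeB HV) => //; apply: place0. Qed.

Lemma placeD z z' c c' : V z c -> V z' c' -> V (z + z') (c + c').
Proof.
by move=> h h'; rewrite -(opprK z') -(opprK c'); apply: (placeB HV) => //; apply: placeN.
Qed.

Lemma place_div z z' c c' : V z c -> V z' c' -> c' != 0 -> V (z / z') (c / c').
Proof. by move=> h h' c0; apply: (placeM HV) => //; apply: (placeV HV). Qed.

Lemma place_eq z z' c c' : V z c -> z = z' -> c = c' -> V z' c'.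
Proof. by move=> h <- <-. Qed.

Lemma placeXn z c n : V z c -> V (z ^+ n) (c ^+ n).
Proof.
move=> h; elim: n => [|n IH]; first by rewrite !expr0; apply: (place1 HV).
by rewrite !exprS; apply: (placeM HV).
Qed.

Lemma place_neq0 z c : V z c -> c != 0 -> z != 0.
Proof.
move=> h c0; apply/eqP=> z0; move: h; rewrite z0 => /place_fun -/(_ HV 0 place0).
by move/eqP: c0.
Qed.

Lemma pregularM z z' : pregular z -> pregular z' -> pregular (z * z').
Proof. by move=> [c h] [d h']; exists (c * d); apply: (placeM HV). Qed.

Lemma pregularD z z' : pregular z -> pregular z' -> pregular (z + z').
Proof. by move=> [c h] [d h']; exists (c + d); apply: placeD. Qed.

Lemma punit_pregular z : punit z -> pregular z.
Proof. by move=> [c _ h]; exists c. Qed.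

Lemma punit_neq0 z : punit z -> z != 0.
Proof. by move=> [c c0 h]; apply: place_neq0 h c0. Qed.

Lemma punit1 : punit 1.
Proof. by exists 1; [rewrite oner_neq0 | apply: (place1 HV)]. Qed.

Lemma punitM z z' : punit z -> punit z' -> punit (z * z').
Proof. by move=> [c c0 h] [d d0 h']; exists (c * d); [rewrite mulf_neq0|apply: (placeM HV)]. Qed.

Lemma punitV z : punit z -> punit z^-1.
Proof. by move=> [c c0 h]; exists c^-1; [rewrite invr_eq0|apply: (placeV HV)]. Qed.

Lemma punitXn z n : punit z -> punit (z ^+ n).
Proof. by move=> [c c0 h]; exists (c ^+ n); [rewrite expf_neq0|apply: placeXn]. Qed.

Lemma punitXz z n : punit z -> punit (z ^ n).
Proof.
by move=> uz; case: n => n; [|rewrite NegzE -exprnN; apply: punitV]; apply: punitXn.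
Qed.

(** The residues of [t' / t] and [t / t'] exist and have product 1, so neither is 0. *)
Lemma puniformizer_quot t t' : puniformizer t -> puniformizer t' -> punit (t' / t).
Proof.
move=> [t0 Vt ht] [t'0 Vt' ht']; have [c hc] := ht _ Vt'; have [d hd] := ht' _ Vt.
have := placeM HV hc hd; rewrite -mulrA (mulKf t0) mulfV // => /(place_fun HV (place1 HV)) e.
exists c => //; apply/eqP => c0; move: e; rewrite c0 mul0r => /eqP.
by rewrite oner_eq0.
Qed.

(** [pord] hides its uniformizer; changing it costs only a power of a unit. This lets two orders be
    compared through a common uniformizer. *)
Lemma pord_wrt t z n : puniformizer t -> pord z n -> exists2 u, punit u & z = t ^ n * u.
Proof.
move=> ut [t' [u [ut' uu ->]]]; exists ((t' / t) ^ n * u).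
  by apply: punitM => //; apply: punitXz; apply: puniformizer_quot.
case: (ut) => t0 _ _.
by rewrite mulrA -expfzMl [t * _]mulrC divfK.
Qed.

Lemma pord_neq0 z n : pord z n -> z != 0.
Proof.
move=> [t [u [[t0 _ _] uu ->]]].
by apply: mulf_neq0; [apply: expfz_neq0|apply: punit_neq0].
Qed.

Lemma pordM z z' n n' : pord z n -> pord z' n' -> pord (z * z') (n + n').
Proof.
move=> [t [u [ut uu ->]]] /(pord_wrt ut) [u' uu' ->].
exists t, (u * u'); split => //; first exact: punitM.
by case: (ut) => t0 _ _; rewrite expfzDr // mulrACA.
Qed.

Lemma pordV z n : pord z n -> pord z^-1 (- n).
Proof.
move=> [t [u [ut uu ->]]]; exists t, u^-1; split => //; first exact: punitV.
by rewrite invfM -invr_expz.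
Qed.

(** [pord] asserts that a uniformizer exists, so one must be supplied even for order 0. *)
Lemma pord_punit t u : puniformizer t -> punit u -> pord u 0.
Proof. by move=> ut uu; exists t, u; rewrite expr0z mul1r. Qed.

Lemma pord_puniformizer t : puniformizer t -> pord t 1.
Proof. by move=> ut; exists t, 1; rewrite expr1z mulr1; split => //; apply: punit1. Qed.

Lemma pordXn z n k : pord z n -> pord (z ^+ k) (n * k%:Z).
Proof.
move=> oz; elim: k => [|k IH].
  rewrite expr0 mulr0; case: oz => t [u [ut _ _]]; exact: (pord_punit ut punit1).
by rewrite exprS intS mulrDr mulr1; apply: pordM.
Qed.

Lemma place_pord_gt0 z n : pord z n -> 0 < n -> V z 0.
Proof.
move=> [t [u [[t0 Vt _] [c c0 hu] ->]]]; case: n => // -[//|n] _.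
by apply: place_eq (placeM HV (placeXn n.+1 Vt) hu) _ _; rewrite ?expr0n ?mul0r.
Qed.

Lemma pregular_pord_ge0 z n : pord z n -> 0 <= n -> pregular z.
Proof.
move=> oz; rewrite le_eqVlt => /orP[/eqP n0|/(place_pord_gt0 oz)]; last by exists 0.
case: oz => t [u [_ uu ->]]; rewrite -n0 expr0z mul1r; exact: punit_pregular.
Qed.

(** A negative order would give [z^-1] residue 0, and then 1 = z z^-1 as well. *)
Lemma pord_ge0 z n : pord z n -> pregular z -> 0 <= n.
Proof.
move=> oz [c hz]; rewrite leNgt; apply/negP => n0.
have n0' : 0 < - n by rewrite oppr_gt0.
have hz' := place_pord_gt0 (pordV oz) n0'.
have := placeM HV hz hz'; rewrite mulfV ?(pord_neq0 oz) // mulr0.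
by move=> /(place_fun HV (place1 HV))/eqP; rewrite oner_eq0.
Qed.

Lemma pord_gt0 z n : pord z n -> V z 0 -> 0 < n.
Proof.
move=> oz hz; rewrite lt_neqAle (pord_ge0 oz) ?andbT; last by exists 0.
apply/eqP=> n0; case: oz => t [u [_ [c c0 hu]]].
rewrite -n0 expr0z mul1r => e; move/eqP: c0; apply.
by apply: (place_fun HV hu); rewrite -e.
Qed.

Lemma pord_uniq z n n' : pord z n -> pord z n' -> n = n'.
Proof.
have le m m' : pord z m -> pord z m' -> m' <= m.
  move=> om om'; rewrite -subr_ge0; apply: pord_ge0 (pordM om (pordV om')) _.
  by rewrite mulfV ?(pord_neq0 om) //; exists 1; apply: (place1 HV).
by move=> oz oz'; apply/eqP; rewrite eq_le !le.
Qed.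

(** Write z + z' = z (1 + z' / z); the second factor has residue 1. *)
Lemma pordD z z' n n' : pord z n -> pord z' n' -> n < n' -> pord (z + z') n.
Proof.
move=> oz oz' nn'; have z0 := pord_neq0 oz; case: (oz) => t [u [ut _ _]].
have -> : z + z' = z * (1 + z' / z) by field.
have o1 : pord (z' / z) (n' - n) by apply: pordM (pordV oz).
rewrite -[n]addr0; apply: pordM => //; apply: (pord_punit ut).
exists (1 + 0); first by rewrite addr0 oner_neq0.
by apply: placeD; [apply: (place1 HV)|apply: place_pord_gt0 o1 _; rewrite subr_gt0].
Qed.

End Place.

(** * Smooth points of plane charts *)

(* [hornerE] without its monoid simplifications, which reassociate the scalars. *)
Definition horner_ringE (R : comNzRingType) :=
  (@hornerD R, @hornerN R, @hornerX R, @hornerC R, @horner_exp R, @hornerM R).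

Lemma size_XsubC_mul (R : idomainType) (a : R) p :
  p != 0 -> size (('X - a%:P) * p) = (size p).+1.
Proof. by move=> p0; rewrite mulrC size_Mmonic ?monicXsubC // size_XsubC addn2. Qed.

(** Reduction modulo y^2 + h y - f. The remainders [a], [b] are chosen before the field and the
    coordinates, so the same pair is valid in the function field, at a point of the curve, and after
    extension of scalars. *)
Lemma curve_reduce (k : fieldType) (h f : {poly k}) (p : {poly {poly k}}) :
  exists a b : {poly k}, forall (L : fieldType) (kappa : {rmorphism k -> L}) x y,
    y ^+ 2 + (map_poly kappa h).[x] * y = (map_poly kappa f).[x] ->
    (map_poly (map_poly kappa) p).[x, y]
    = (map_poly kappa a).[x] + (map_poly kappa b).[x] * y.
Proof.
(* The coefficients of [p] are polynomials in y: they are reduced first, then the outer induction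
   runs over powers of x. *)
have inner (c : {poly k}) : exists a b : {poly k},
    forall (L : fieldType) (kappa : {rmorphism k -> L}) x y,
    y ^+ 2 + (map_poly kappa h).[x] * y = (map_poly kappa f).[x] ->
    (map_poly kappa c).[y] = (map_poly kappa a).[x] + (map_poly kappa b).[x] * y.
  elim/poly_ind: c => [|c c0 [a [b ab]]].
    by exists 0, 0 => L kappa x y _; rewrite !rmorph0 !horner0 mul0r addr0.
  exists (b * f + c0%:P), (a - b * h) => L kappa x y e.
  rewrite !(rmorphD, rmorphM, rmorphN) /= map_polyX !map_polyC /= !horner_ringE (ab _ _ _ _ e) -e.
  by ring.
elim/poly_ind: p => [|p c [a [b ab]]].
  by exists 0, 0 => L kappa x y _; rewrite !rmorph0 !horner0 mul0r addr0.
have [a' [b' ab']] := inner c.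
exists (a * 'X + a'), (b * 'X + b') => L kappa x y e.
rewrite !(rmorphD, rmorphM) /= map_polyX map_polyC /= map_polyX !horner_ringE.
by rewrite (ab _ _ _ _ e) (ab' _ _ _ _ e); ring.
Qed.

Section Chart.
Variables (K L : fieldType) (kappa : {rmorphism K -> L}) (x y : L).
Variables (h f : {poly K}) (al be : K).
Local Notation ev p := (map_poly kappa p).[x].
Local Notation ev2 p := (map_poly (map_poly kappa) p).[x, y].

Definition chart_value (z : L) (c : K) : Prop :=
  exists p q : {poly {poly K}},
    [/\ q.[al, be] != 0, z = ev2 p / ev2 q & c = p.[al, be] / q.[al, be]].

Hypothesis eq_xy : y ^+ 2 + ev h * y = ev f.
Hypothesis free_xy : forall a b, ev a + ev b * y = 0 -> a = 0 /\ b = 0.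
Hypothesis eq_ab : be ^+ 2 + h.[al] * be = f.[al].

Lemma chart_reduce p : exists a b : {poly K},
  ev2 p = ev a + ev b * y /\ p.[al, be] = a.[al] + b.[al] * be.
Proof.
have [a [b ab]] := curve_reduce h f p; exists a, b; split; first exact: ab.
have id2 q : map_poly (map_poly (@idfun K)) q = q.
  by rewrite map_poly_id // => c _; rewrite map_poly_id.
have := ab _ (@idfun K) al be; rewrite id2 !map_poly_id //; apply; exact: eq_ab.
Qed.

(** A polynomial that is zero in [L] has remainder 0 + 0 y by freeness, hence vanishes at the point.
    This is what makes residues well defined. *)
Lemma ev2_neq0 q : q.[al, be] != 0 -> ev2 q != 0.
Proof.
have [a [b [-> ->]]] := chart_reduce q; apply: contraNneq => /free_xy [-> ->].
by rewrite !horner0 mul0r addr0.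
Qed.

Lemma chart_place : place chart_value.
Proof.
split.
- move=> z c d [p [q [q0 -> ->]]] [p' [q' [q0' e ->]]].
  apply/eqP; rewrite eqr_div // -subr_eq0; apply: contraT => nz.
  have := @ev2_neq0 (p * q' - p' * q).
  rewrite !(rmorphD, rmorphM, rmorphN) /= !horner_ringE => /(_ nz) /negP[].
  by rewrite subr_eq0 -eqr_div ?ev2_neq0 // e.
- by exists 1, 1; rewrite !rmorph1 !horner_ringE !invr1 !mulr1 oner_neq0.
- move=> z z' c c' [p [q [q0 -> ->]]] [p' [q' [q0' -> ->]]].
  exists (p * q' - p' * q), (q * q').
  rewrite !(rmorphD, rmorphM, rmorphN) /= !horner_ringE mulf_neq0 //.
  have Q0 := ev2_neq0 q0; have Q0' := ev2_neq0 q0'.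
  by split => //; field; apply/andP.
- move=> z z' c c' [p [q [q0 -> ->]]] [p' [q' [q0' -> ->]]].
  exists (p * p'), (q * q').
  rewrite !(rmorphD, rmorphM, rmorphN) /= !horner_ringE mulf_neq0 //.
  have Q0 := ev2_neq0 q0; have Q0' := ev2_neq0 q0'.
  by split => //; field; apply/andP.
move=> z c [p [q [q0 -> ->]]] p0; exists q, p.
by rewrite !invf_div; split => //; apply: contraNneq p0 => ->; rewrite mul0r.
Qed.

Let CP := chart_place.

Lemma chart_value_ev2 p : chart_value (ev2 p) p.[al, be].
Proof. by exists p, 1; rewrite !rmorph1 !horner_ringE !invr1 !mulr1 oner_neq0. Qed.

Lemma chart_value_ev a : chart_value (ev a) a.[al].
Proof.
apply: place_eq (chart_value_ev2 (map_poly polyC a)) _ _; last first.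
  by rewrite -[al%:P]/(polyC al) horner_map /= hornerC.
rewrite -map_poly_comp (eq_map_poly (g := polyC \o kappa)); last first.
  by move=> c /=; rewrite map_polyC.
by rewrite map_poly_comp horner_map /= hornerC.
Qed.

Lemma chart_value_y : chart_value y be.
Proof. by have := chart_value_ev2 'X%:P; rewrite map_polyC /= map_polyX !horner_ringE. Qed.

Lemma chart_value_xB : chart_value (x - kappa al) 0.
Proof.
have := chart_value_ev ('X - al%:P).
by rewrite rmorphB /= map_polyX map_polyC /= !horner_ringE subrr.
Qed.

Lemma chart_value_yB : chart_value (y - kappa be) 0.
Proof.
have := chart_value_ev be%:P; rewrite map_polyC !horner_ringE /= => kb.
by rewrite -(subrr be); apply: (placeB CP) => //; apply: chart_value_y.
Qed.

Lemma ev_root a : a.[al] = 0 ->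
  exists2 a', a = ('X - al%:P) * a' & ev a = (x - kappa al) * ev a'.
Proof.
move=> /rootP/factor_theorem [a' ->]; exists a'; first exact: mulrC.
by rewrite rmorphM rmorphB /= map_polyX map_polyC /= !horner_ringE mulrC.
Qed.

(** A polynomial vanishing at the point reduces to (x - al) c + b (y - be), so x - al and y - be
    generate the maximal ideal and only these two need to be divisible by [t]. *)
Lemma chart_puniformizer t : t != 0 -> chart_value t 0 ->
  pregular chart_value ((x - kappa al) / t) ->
  pregular chart_value ((y - kappa be) / t) -> puniformizer chart_value t.
Proof.
move=> t0 Vt rx ry; split => // s [p [q [q0 -> e]]].
have {e} : p.[al, be] = 0.
  by apply/eqP; move/esym/eqP: e; rewrite mulf_eq0 invr_eq0 (negPf q0) orbF.
have [a [b [-> ->]]] := chart_reduce p => e.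
have [|c _ ec] := @ev_root (a + b * be%:P); first by rewrite !horner_ringE.
have -> : ev a + ev b * y = (x - kappa al) * ev c + ev b * (y - kappa be).
  by rewrite -ec rmorphD rmorphM /= map_polyC !horner_ringE /=; ring.
have Q0 := ev2_neq0 q0.
have -> : ((x - kappa al) * ev c + ev b * (y - kappa be)) / ev2 q / t
   = ((x - kappa al) / t * ev c + ev b * ((y - kappa be) / t)) / ev2 q.
  by field; apply/andP.
have r_ev d : pregular chart_value (ev d) by exists d.[al]; apply: chart_value_ev.
apply: (pregularM CP).
  by apply: (pregularD CP); apply: (pregularM CP).
by exists (q.[al, be]^-1); apply: (placeV CP) => //; apply: chart_value_ev2.
Qed.

Let xB_neq0 : x - kappa al != 0.
Proof.
apply/eqP=> e; have [] := @free_xy ('X - al%:P) 0; last first.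
  by move=> /eqP; rewrite polyXsubC_eq0.
by rewrite rmorph0 horner0 mul0r addr0 rmorphB /= map_polyX map_polyC !horner_ringE.
Qed.

Let yB_neq0 : y - kappa be != 0.
Proof.
apply/eqP=> e; have [] := @free_xy (- be%:P) 1; last first.
  by move=> _ /eqP; rewrite oner_eq0.
by rewrite rmorph1 rmorphN /= map_polyC !horner_ringE /= mul1r addrC.
Qed.

(* Taylor expansion of the equation at [(al, be)]. *)
Let taylor : exists A H : {poly K}, [/\
  A.[al] = h^`().[al] * be - f^`().[al],
  ev h = kappa h.[al] + (x - kappa al) * ev H
  & (y - kappa be) * (y + kappa be + ev h) = - (x - kappa al) * ev A].
Proof.
have dif (p : {poly K}) : exists2 P, ev p = kappa p.[al] + (x - kappa al) * ev P
    & P.[al] = p^`().[al].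
  have /factor_theorem [P eP] : root (p - p.[al]%:P) al.
    by rewrite rootE !horner_ringE subrr.
  exists P.
    have : ev (p - p.[al]%:P) = ev (P * ('X - al%:P)) by rewrite eP.
    rewrite rmorphB rmorphM rmorphB /= map_polyX !map_polyC /= !horner_ringE.
    move=> /(canRL (subrK _)) ->.
    by rewrite addrC mulrC.
  have := congr1 (fun q => q^`().[al]) eP.
  rewrite derivB derivC subr0 derivM derivB derivX derivC subr0 => ->.
  by rewrite !horner_ringE subrr mulr0 add0r mulr1.
have [H eH dH] := dif h; have [G eG dG] := dif f.
exists (H * be%:P - G), H; split => //; first by rewrite !horner_ringE dH dG.
rewrite rmorphB rmorphM /= map_polyC !horner_ringE /=.
have := eq_xy; rewrite eG -eq_ab rmorphD rmorphXn rmorphM /= => e.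
have e' : (x - kappa al) * ev G = y ^+ 2 + ev h * y - (kappa be ^+ 2 + kappa h.[al] * kappa be).
  by rewrite e; ring.
rewrite mulNr mulrBr e' mulrA.
have -> : (x - kappa al) * ev H = ev h - kappa h.[al] by rewrite eH; ring.
by ring.
Qed.

(** In the Taylor identity the factor y + be + h(x) has residue 2 be + h(al), a unit, so x - al
    divides y - be. *)
Lemma unramified_xB : be *+ 2 + h.[al] != 0 -> puniformizer chart_value (x - kappa al).
Proof.
move=> ur; have [A [H [_ _ e]]] := taylor.
have VB : chart_value (y + kappa be + ev h) (be *+ 2 + h.[al]).
  apply: (placeD CP); last exact: chart_value_ev.
  rewrite mulr2n; apply: (placeD CP); first exact: chart_value_y.
  by have := chart_value_ev be%:P; rewrite map_polyC !horner_ringE.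
have B0 := place_neq0 CP VB ur.
apply: chart_puniformizer => //; first exact: chart_value_xB.
  by rewrite mulfV //; apply/(punit_pregular (punit1 CP)).
have -> : (y - kappa be) / (x - kappa al) = - ev A / (y + kappa be + ev h).
  by apply/eqP; rewrite eqr_div // e; apply/eqP; ring.
exists (- A.[al] / (be *+ 2 + h.[al])); apply: (place_div CP) => //.
by apply: (placeN CP); apply: chart_value_ev.
Qed.

(** Here y + be + h(x) = (y - be) + (x - al) H, so the Taylor identity becomes (y - be)^2 = -(x -
    al) (A + H (y - be)), and smoothness makes the last factor a unit. *)
Lemma ramified_xB : be *+ 2 + h.[al] = 0 -> h^`().[al] * be - f^`().[al] != 0 ->
  puniformizer chart_value (y - kappa be)
  /\ punit chart_value ((x - kappa al) / (y - kappa be) ^+ 2).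
Proof.
move=> rm sm; have [A [H [eA eH e]]] := taylor; rewrite -eA in sm.
have VA : chart_value (- (ev A + ev H * (y - kappa be))) (- (A.[al] + H.[al] * 0)).
  apply: (placeN CP); apply: (placeD CP); first exact: chart_value_ev.
  by apply: (placeM CP); [apply: chart_value_ev | apply: chart_value_yB].
rewrite mulr0 addr0 in VA; have sm' : - A.[al] != 0 by rewrite oppr_eq0.
have A0 := place_neq0 CP VA sm'.
have q : (y - kappa be) ^+ 2 = (x - kappa al) * (- (ev A + ev H * (y - kappa be))).
  have eh : kappa h.[al] = - kappa be *+ 2.
    by rewrite mulNrn -rmorphMn -rmorphN; congr (kappa _); apply/eqP; rewrite -addr_eq0 addrC rm.
  have : (y - kappa be) * (y + kappa be + ev h) = - (x - kappa al) * ev A by [].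
  rewrite eH eh => e'.
  have -> : (y - kappa be) ^+ 2 = (y - kappa be) *
    (y + kappa be + (- kappa be *+ 2 + (x - kappa al) * ev H))
    - (y - kappa be) * (x - kappa al) * ev H by ring.
  by rewrite e'; ring.
have u : (x - kappa al) / (y - kappa be) ^+ 2 = (- (ev A + ev H * (y - kappa be)))^-1.
  by rewrite q invfM mulrA mulfV // mul1r.
have U : punit chart_value ((x - kappa al) / (y - kappa be) ^+ 2).
  by rewrite u; apply: (punitV CP); exists (- A.[al]).
split => //; apply: chart_puniformizer => //; first exact: chart_value_yB.
  have -> : (x - kappa al) / (y - kappa be) = (x - kappa al) / (y - kappa be) ^+ 2 * (y - kappa be).
    by field.
  apply: (pregularM CP); first exact: punit_pregular.
  by exists 0; apply: chart_value_yB.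
by rewrite mulfV //; apply/(punit_pregular (punit1 CP)).
Qed.

Hypothesis smooth_ab : ~ (be *+ 2 + h.[al] = 0 /\ h^`().[al] * be - f^`().[al] = 0).

Lemma chart_puniformizer_ex : exists t, puniformizer chart_value t.
Proof.
have [ur|rm] := boolP (be *+ 2 + h.[al] != 0); first by exists (x - kappa al); apply: unramified_xB.
exists (y - kappa be); apply: (ramified_xB _ _).1; first by apply/eqP; rewrite -[_ == _]negbK.
by apply/eqP => e; apply: smooth_ab; split => //; apply/eqP; rewrite -[_ == _]negbK.
Qed.

Lemma chart_pord_xB : exists n, pord chart_value (x - kappa al) n.
Proof.
have [ur|rm] := boolP (be *+ 2 + h.[al] != 0).
  by exists 1; apply: (pord_puniformizer CP); apply: unramified_xB.
have [||ut uu] := ramified_xB; first by apply/eqP; rewrite -[_ == _]negbK.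
  by apply/eqP => e; apply: smooth_ab; split => //; apply/eqP; rewrite -[_ == _]negbK.
exists 2; exists (y - kappa be), ((x - kappa al) / (y - kappa be) ^+ 2).
by split => //; rewrite -exprnP mulrC divfK // expf_neq0.
Qed.

Lemma chart_pord_ev a : a != 0 -> exists n, pord chart_value (ev a) n.
Proof.
have [n] := ubnP (size a); elim: n a => // n IH a sa a0.
have [e|ne] := eqVneq a.[al] 0; last first.
  have [t ut] := chart_puniformizer_ex; exists 0; apply: (pord_punit ut).
  by exists a.[al] => //; apply: chart_value_ev.
have [a' ea ->] := ev_root e.
have a'0 : a' != 0 by apply: contraNneq a0 => a'0; rewrite ea a'0 mulr0.
have [|//|m om] := IH a'.
  by move: sa; rewrite ea size_XsubC_mul // ltnS.
by have [k ok] := chart_pord_xB; exists (k + m); apply: (pordM CP).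
Qed.

(** A nonzero residue gives order 0, and common factors x - al are stripped by induction. What
    remains is a function that vanishes at the point with b(al) nonzero. *)
Lemma chart_pord_ev_y a b : (a != 0) || (b != 0) ->
  exists n, pord chart_value (ev a + ev b * y) n.
Proof.
have [n] := ubnP (size a + size b); elim: n a b => // n IH a b sab ab0.
have Vr : chart_value (ev a + ev b * y) (a.[al] + b.[al] * be).
  apply: (placeD CP); first exact: chart_value_ev.
  by apply: (placeM CP); [apply: chart_value_ev|apply: chart_value_y].
have [r0|ne] := eqVneq (a.[al] + b.[al] * be) 0; last first.
  have [t ut] := chart_puniformizer_ex; exists 0; apply: (pord_punit ut).
  by exists (a.[al] + b.[al] * be).
(* If b(al) = 0 then a(al) = 0 too. The total size drops because at least one of the two quotients
   is nonzero, which [szl] records. *)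
have [b0|nb0] := eqVneq b.[al] 0.
  have a0 : a.[al] = 0 by move: r0; rewrite b0 mul0r addr0.
  have [a' ea ea'] := ev_root a0; have [b' eb eb'] := ev_root b0.
  have szl (c d : {poly K}) : c = ('X - al%:P) * d -> (size d + (d != 0%R) <= size c)%N.
    by move=> ->; have [->|d0] := eqVneq d 0; rewrite ?size_poly0 // size_XsubC_mul // addn1.
  have ab'0 : (a' != 0) || (b' != 0).
    by move: ab0; rewrite ea eb !mulf_eq0 !polyXsubC_eq0.
  have [|//|m om] := IH a' b'.
    move: sab ab'0 (szl _ _ ea) (szl _ _ eb).
    by case: (a' != 0); case: (b' != 0) => //=; lia.
  have [k ok] := chart_pord_xB; exists (k + m); rewrite ea' eb'.
  by rewrite -mulrA -mulrDr; apply: (pordM CP).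
have [ur|rm] := boolP (be *+ 2 + h.[al] != 0).
  (* the conjugate of [a + b y] is a unit, so [a + b y] has the order of its norm *)
  have Vc : chart_value (ev a - ev b * ev h - ev b * y) (a.[al] - b.[al] * h.[al] - b.[al] * be).
    apply: (placeB CP).
      apply: (placeB CP); first exact: chart_value_ev.
      by apply: (placeM CP); apply: chart_value_ev.
    by apply: (placeM CP); [apply: chart_value_ev|apply: chart_value_y].
  have c0 : a.[al] - b.[al] * h.[al] - b.[al] * be != 0.
    have -> : a.[al] - b.[al] * h.[al] - b.[al] * be =
      a.[al] + b.[al] * be - b.[al] * (be *+ 2 + h.[al]) by ring.
    by rewrite r0 sub0r oppr_eq0 mulf_neq0.
  have u0 := place_neq0 CP Vc c0.
  set N := a ^+ 2 - a * b * h - b ^+ 2 * f.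
  have eN : ev N = (ev a + ev b * y) * (ev a - ev b * ev h - ev b * y).
    rewrite /N !(rmorphB, rmorphM, rmorphXn) /= !horner_ringE -eq_xy; ring.
  have N0 : N != 0.
    have rn0 : ev a + ev b * y != 0.
      apply/eqP => /free_xy [a0 b0]; by move: ab0; rewrite a0 b0 eqxx.
    apply: contraTneq (mulf_neq0 rn0 u0) => eN0.
    by rewrite -eN eN0 rmorph0 horner0 eqxx.
  have [m om] := chart_pord_ev N0; exists (m - 0).
  have [t ut] := chart_puniformizer_ex.
  have -> : ev a + ev b * y = ev N / (ev a - ev b * ev h - ev b * y).
    by rewrite eN mulfK.
  apply: (pordM CP) => //; apply: (pordV CP); apply: (pord_punit ut).
  by exists (a.[al] - b.[al] * h.[al] - b.[al] * be).
have [||ut [k k0 Vk]] := ramified_xB; first by apply/eqP; rewrite -[_ == _]negbK.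
  by apply/eqP => e; apply: smooth_ab; split => //; apply/eqP; rewrite -[_ == _]negbK.
have [|c _ ec] := @ev_root (a + b * be%:P); first by rewrite !horner_ringE.
(* Since a + b y = (x - al) c + b (y - be) and x - al is a unit times (y - be)^2, the order is
   exactly 1: the cofactor of y - be has residue b(al). *)
exists 1, (y - kappa be), ((x - kappa al) / (y - kappa be) ^+ 2 * (y - kappa be) * ev c + ev b).
split => //; last first.
  rewrite expr1z.
  have -> : (y - kappa be) *
      ((x - kappa al) / (y - kappa be) ^+ 2 * (y - kappa be) * ev c + ev b)
      = (x - kappa al) * ev c + ev b * (y - kappa be) by field.
  by rewrite -ec rmorphD rmorphM /= map_polyC !horner_ringE /=; ring.
exists (k * 0 * c.[al] + b.[al]); first by rewrite mulr0 mul0r add0r.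
apply: (placeD CP); last exact: chart_value_ev.
apply: (placeM CP); last exact: chart_value_ev.
by apply: (placeM CP) => //; apply: chart_value_yB.
Qed.

End Chart.

(** * The function field and the point at infinity *)

(** The reciprocal polynomial x^n p(1/x) for a prescribed n, which may exceed the degree; it
    expresses polynomials in x through the coordinate w = 1/x. *)
Definition rev_poly (R : nzSemiRingType) n (p : {poly R}) : {poly R} :=
  \poly_(i < n.+1) p`_(n - i).

Lemma size_rev_poly (R : nzSemiRingType) n (p : {poly R}) : (size (rev_poly n p) <= n.+1)%N.
Proof. exact: size_poly. Qed.

Lemma coef_rev_poly (R : nzSemiRingType) n (p : {poly R}) i :
  (rev_poly n p)`_i = if (i <= n)%N then p`_(n - i) else 0.
Proof. by rewrite coef_poly ltnS. Qed.

Lemma rev_polyK (R : nzSemiRingType) n (p : {poly R}) :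
  (size p <= n.+1)%N -> rev_poly n (rev_poly n p) = p.
Proof.
move=> sp; apply/polyP => i; rewrite !coef_rev_poly leq_subr.
case: leqP => [le|lt]; first by rewrite subKn.
by rewrite nth_default // (leq_trans sp).
Qed.

Lemma rev_poly_horner (K L : fieldType) (kappa : {rmorphism K -> L}) x n (p : {poly K}) :
  x != 0 -> (size p <= n.+1)%N ->
  (map_poly kappa (rev_poly n p)).[x^-1] = (map_poly kappa p).[x] / x ^+ n.
Proof.
move=> x0 sp; rewrite (@horner_coef_wide _ n.+1); last first.
  by rewrite size_map_poly size_rev_poly.
rewrite (@horner_coef_wide _ n.+1 (map_poly kappa p)) ?size_map_poly //.
rewrite mulr_suml (reindex_inj rev_ord_inj) /=; apply: eq_bigr => i _.
have le_in : (i <= n)%N by rewrite -ltnS.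
rewrite !coef_map coef_rev_poly /= subSS leq_subr subKn // -mulrA; congr (_ * _).
have -> : x ^+ n = x ^+ (n - i) * x ^+ i by rewrite -exprD subnK.
by rewrite exprVn; field; rewrite !expf_neq0.
Qed.


(* The function field is replaced by an abstract field [L] with coordinates [x]
   and [y]: rewriting in the concrete quotient [funfield C] makes unification
   diverge. *)
Section CurveModel.
Variables (K : fieldType) (g : nat) (C : hyperelliptic K g) (L : fieldType).
Local Notation h := (hpol C).
Local Notation f := (fpol C).

Section Model.
Variables (kappa : {rmorphism K -> L}) (x y : L).
Local Notation ev p := (map_poly kappa p).[x].

Record curve_model : Prop := CurveModel {
  model_eq : y ^+ 2 + ev h * y = ev f;
  model_free : forall a b, ev a + ev b * y = 0 -> a = 0 /\ b = 0
}.
End Model.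

Section Ratfun.
Variables (r : {rmorphism {fraction {poly K}} -> L}).
Let kappa : {rmorphism K -> L} := r \o @FracField.tofrac {poly K} \o polyC.

Lemma ratfun_horner p :
  (map_poly kappa p).[r (FracField.tofrac 'X)] = r (FracField.tofrac p).
Proof.
elim/poly_ind: p => [|p c IH]; first by rewrite !rmorph0 horner0.
by rewrite !(rmorphD, rmorphM) /= map_polyX map_polyC !horner_ringE IH.
Qed.

(** A relation a + b y = 0 with b nonzero would make -a/b a root of [curve_poly] in K(x). *)
Lemma ratfun_model y : y * y + r (FracField.tofrac h) * y - r (FracField.tofrac f) = 0 ->
  curve_model kappa (r (FracField.tofrac 'X)) y.
Proof.
move=> /subr0_eq; rewrite -expr2 => e; split=> [|a b]; rewrite !ratfun_horner //.
have y_not z : y != r z.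
  apply/eqP => ey; move: e; rewrite ey -rmorphXn -rmorphM -rmorphD.
  move/fmorph_inj => e'; have := curve_poly_noroot C z.
  by rewrite rootE /curve_poly !horner_ringE e' subrr eqxx.
have [-> e0|b0 e0] := eqVneq b 0.
  move: e0; rewrite !rmorph0 mul0r addr0 => /eqP.
  by rewrite fmorph_eq0 tofrac_eq0 => /eqP ->.
have B0 : r (FracField.tofrac b) != 0 by rewrite fmorph_eq0 tofrac_eq0.
have := y_not (- (FracField.tofrac a / FracField.tofrac b)).
rewrite rmorphN fmorph_div /= => /eqP[]; rewrite -mulNr; apply: (canRL (mulfK B0)).
by rewrite mulrC; apply/eqP; rewrite -addr_eq0 addrC e0.
Qed.
End Ratfun.

Variables (kappa : {rmorphism K -> L}) (x y : L).
Local Notation ev p := (map_poly kappa p).[x].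

Hypothesis M : curve_model kappa x y.
Let eq_xy := model_eq M.
Let free_xy := model_free M.

Lemma model_x_neq0 : x != 0.
Proof.
apply/eqP => x0; have [|/eqP] := @free_xy 'X 0; last by rewrite polyX_eq0.
by rewrite map_polyX rmorph0 !horner_ringE x0 mul0r addr0.
Qed.

(** * The chart at infinity *)

Local Notation w := (x^-1).
Local Notation s := (y / x ^+ g.+1).
Local Notation evw p := (map_poly (kappa) p).[w].
Local Notation h1 := (rev_poly g.+1 h).
Local Notation f1 := (rev_poly (2 * g.+1) f).

Lemma chart_infty_eq : s ^+ 2 + evw h1 * s = evw f1.
Proof.
have x0 := model_x_neq0.
rewrite !rev_poly_horner ?size_fpol ?(leqW (size_hpol C)) //; last by lia.
rewrite -eq_xy mul2n -addnn exprD; field.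
by rewrite expf_neq0.
Qed.

(** Multiplying the relation by x^(n + g + 1), with n bounding both degrees, turns it into one
    between 1 and y over K[x]. *)
Lemma chart_infty_free a b : evw a + evw b * s = 0 -> a = 0 /\ b = 0.
Proof.
have x0 := model_x_neq0.
pose n := maxn (size a) (size b).
have sa : (size a <= n.+1)%N by rewrite leqW // leq_maxl.
have sb : (size b <= n.+1)%N by rewrite leqW // leq_maxr.
rewrite -[in evw a](rev_polyK sa) -[in evw b](rev_polyK sb).
rewrite !rev_poly_horner ?size_rev_poly // => e.
have [|/eqP ra rb] := @free_xy (rev_poly n a * 'X^(g.+1)) (rev_poly n b).
  apply: (mulIf (x := (x ^+ n * x ^+ g.+1)^-1)); first by rewrite invr_eq0 mulf_neq0 ?expf_neq0.
  rewrite mul0r -[RHS]e rmorphM /= map_polyXn !horner_ringE.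
  by field; rewrite !expf_neq0.
move: ra; rewrite mulf_eq0 (negPf (monic_neq0 (monicXn _ _))) orbF => /eqP ra.
by rewrite -(rev_polyK sa) -(rev_polyK sb) ra rb; split; apply/polyP => i;
  rewrite coef_rev_poly !coef0 if_same.
Qed.

Lemma chart_infty_point : 0 ^+ 2 + h1.[0] * 0 = f1.[0].
Proof.
rewrite expr0n mulr0 add0r horner_coef0 coef_rev_poly subn0 /= nth_default //.
by rewrite size_fpol; lia.
Qed.

Lemma chart_infty_ramified : 0 *+ 2 + h1.[0] = 0.
Proof.
rewrite mul0rn add0r horner_coef0 coef_rev_poly subn0 /= nth_default //.
exact: size_hpol.
Qed.

(** The linear coefficient of [f1] is the coefficient of x^(2g+1) in f, which is 1: this is the
    smoothness of the point at infinity. *)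
Lemma chart_infty_dx : h1^`().[0] * 0 - f1^`().[0] = -1.
Proof.
rewrite mulr0 sub0r !horner_coef0 coef_deriv coef_rev_poly mulr1n.
have -> : (2 * g.+1 - 1)%N = (size f).-1 by rewrite size_fpol; lia.
by rewrite -lead_coefE (monicP (fpol_monic C)).
Qed.

Hypothesis smooth : affine_nonsingular C.

Definition model_value (P : point K) : L -> K -> Prop :=
  if P is Some (a, b) then chart_value kappa x y a b else chart_value kappa w s 0 0.

Lemma model_place P : on_curve C P -> place (model_value P).
Proof.
case: P => [[a b]|] /= Pon.
  by apply: (chart_place eq_xy free_xy); apply/eqP.
exact: (chart_place chart_infty_eq chart_infty_free chart_infty_point).
Qed.

Lemma infty_puniformizer :
  puniformizer (model_value Pinf) s /\ punit (model_value Pinf) (w / s ^+ 2).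
Proof.
have := @ramified_xB _ _ _ _ _ _ _ 0 0 chart_infty_eq chart_infty_free chart_infty_point.
rewrite rmorph0 !subr0; apply; first exact: chart_infty_ramified.
by rewrite chart_infty_dx oppr_eq0 oner_neq0.
Qed.

Lemma infty_pord_x : pord (model_value Pinf) x (- 2).
Proof.
have Pl := @model_place Pinf isT.
have [us uw] := infty_puniformizer.
rewrite -[x]invrK; apply: (pordV Pl); exists s, (w / s ^+ 2); split => //.
have [s0 _ _] := us.
by rewrite -exprnP mulrC divfK // expf_neq0.
Qed.

(** The function is the reversed polynomial at w, and w vanishes at infinity, so its residue is the
    constant coefficient of the reversal. For n above the degree of [a] the residue is 0. *)
Lemma infty_value_rev n (a : {poly K}) : (size a <= n.+1)%N ->
  model_value Pinf (ev a / x ^+ n) a`_n.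
Proof.
move=> sa; have x0 := model_x_neq0.
have := @chart_value_ev _ _ kappa w s 0 0 (rev_poly n a).
by rewrite rev_poly_horner // horner_coef0 coef_rev_poly subn0.
Qed.

Lemma infty_pord_ev (a : {poly K}) : a != 0 ->
  pord (model_value Pinf) (ev a) (- 2 * (size a).-1%:Z).
Proof.
move=> a0; have Pl := @model_place Pinf isT; have x0 := model_x_neq0.
have -> : ev a = x ^+ (size a).-1 * (ev a / x ^+ (size a).-1) by rewrite mulrC divfK ?expf_neq0.
rewrite -[X in pord _ _ X]addr0; apply: (pordM Pl).
  exact: (pordXn Pl) infty_pord_x.
have [us _] := infty_puniformizer; apply: (pord_punit us).
exists (lead_coef a); rewrite ?lead_coef_eq0 //; apply: infty_value_rev; lia.
Qed.

Lemma infty_pord_y : pord (model_value Pinf) y (- (2 * g + 1)%N%:Z).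
Proof.
have Pl := @model_place Pinf isT; have x0 := model_x_neq0.
have [us _] := infty_puniformizer.
have -> : y = s * x ^+ g.+1 by rewrite divfK ?expf_neq0.
have -> : - (2 * g + 1)%N%:Z = 1 + (- 2) * g.+1%:Z by lia.
apply: (pordM Pl); first exact: (pord_puniformizer Pl).
exact: (pordXn Pl) infty_pord_x.
Qed.

Lemma model_pord P (a b : {poly K}) : on_curve C P -> (a != 0) || (b != 0) ->
  exists n, pord (model_value P) (ev a + ev b * y) n.
Proof.
case: P => [[al be]|] Pon ab0.
  apply: (chart_pord_ev_y eq_xy free_xy _ _ ab0); first exact/eqP.
  exact: smooth.
have Pl := @model_place Pinf isT; have x0 := model_x_neq0.
pose n := maxn (size a) (size b).
have sa : (size a <= n.+1)%N by rewrite leqW // leq_maxl.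
have sb : (size b <= n.+1)%N by rewrite leqW // leq_maxr.
have rev0 (c : {poly K}) : (size c <= n.+1)%N -> rev_poly n c = 0 -> c = 0.
  move=> sc r0; rewrite -(rev_polyK sc) r0; apply/polyP => i.
  by rewrite coef_rev_poly !coef0 if_same.
(* In the coordinates w, s the function a + b y is x^(n+g+1) times w^(g+1) rev(a) + rev(b) s, to
   which the chart result applies. *)
have [||m om] := @chart_pord_ev_y _ _ _ _ _ _ _ 0 0 chart_infty_eq chart_infty_free
  chart_infty_point _ ('X^(g.+1) * rev_poly n a) (rev_poly n b).
- by move=> [_ /eqP]; rewrite chart_infty_dx oppr_eq0 oner_eq0.
- rewrite mulf_eq0 (negPf (monic_neq0 (monicXn _ _))) /=.
  apply: contraTT ab0; rewrite !negb_or !negbK.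
  by move=> /andP[/eqP/(rev0 _ sa) -> /eqP/(rev0 _ sb) ->]; rewrite eqxx.
exists (m + (- 2) * (n + g.+1)%N%:Z).
have -> : ev a + ev b * y =
    (evw ('X^(g.+1) * rev_poly n a) + evw (rev_poly n b) * s) * x ^+ (n + g.+1).
  rewrite rmorphM /= map_polyXn !horner_ringE !rev_poly_horner // exprD exprVn.
  by field; rewrite !expf_neq0.
by apply: (pordM Pl om); apply: (pordXn Pl) infty_pord_x.
Qed.

End CurveModel.

Section FunctionField.
Variables (K : fieldType) (g : nat) (C : hyperelliptic K g).

Lemma funfield_model : curve_model C (constF C) (xF C) (yF C).
Proof.
apply: (ratfun_model (r := of_ratfun C)).
pose q p : funfield C := in_qpoly (curve_poly C) p.
have qB a b : q (a - b) = q a - q b by exact: raddfB (in_qpoly _) _ _.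
have qD a b : q (a + b) = q a + q b by exact: raddfD (in_qpoly _) _ _.
have qM a b : q (a * b) = q a * q b by exact: in_qpolyM.
have : q (curve_poly C) = 0.
  apply/val_inj; rewrite /= /mk_monic size_curve_poly curve_poly_monic /=.
  exact: Pdiv.RingMonic.rmodpp (curve_poly_monic C).
by rewrite /curve_poly expr2 qB qD qM qM.
Qed.

Lemma has_valueE P (z : funfield C) c :
  has_value P z c <-> model_value g (constF C) (xF C) (yF C) P z c.
Proof. by case: P => [[a b]|]. Qed.

Lemma has_ordE P (z : funfield C) n :
  has_ord P z n <-> pord (model_value g (constF C) (xF C) (yF C) P) z n.
Proof. by case: P => [[a b]|]. Qed.

End FunctionField.

(** * Riemann-Roch spaces over the algebraic closure *)

Lemma mup_factor (K : fieldType) (c : K) (p : {poly K}) : p != 0 ->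
  exists2 q, p = ('X - c%:P) ^+ mup c p * q & q.[c] != 0.
Proof.
move=> p0; have /dvdpP [q e] : ('X - c%:P) ^+ mup c p %| p by rewrite -mup_geq.
exists q; first by rewrite mulrC.
have := ltnn (mup c p); rewrite mup_geq // exprSr {2}e; apply: contraFN => /eqP q0.
by rewrite mulrC dvdp_mul // dvdp_XsubCl rootE q0.
Qed.

Lemma dvdp_mup (K : closedFieldType) (p q : {poly K}) : p != 0 ->
  (forall c, ('X - c%:P) ^+ mup c p %| q) -> p %| q.
Proof.
have [n] := ubnP (size p); elim: n p q => // n IH p q sp p0 pq.
have [s1|s1] := eqVneq (size p) 1%N.
  by move/eqP: s1; rewrite size_poly_eq1 => /eqp_dvdl ->; apply: dvd1p.
have [c /factor_theorem [p1 ep]] := closed_rootP p s1.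
have p10 : p1 != 0 by apply: contraNneq p0 => p10; rewrite ep p10 mul0r.
have Xc0 (d : K) : 'X - d%:P != 0 by rewrite polyXsubC_eq0.
have mupp d : mup d p = ((c == d) + mup d p1)%N.
  rewrite ep mulrC mupM // -['X - c%:P]expr1 mup_XsubCX.
  by case: (c == d).
have /dvdpP [q1 eq] : 'X - c%:P %| q.
  apply: dvdp_trans (pq c); rewrite mupp eqxx exprS; exact: dvdp_mulIl.
rewrite ep eq dvdp_mul2r //; apply: IH => // [|d].
  by move: sp; rewrite ep mulrC size_XsubC_mul.
have := pq d; rewrite mupp eq; have [->|cd] := eqVneq c d.
  by rewrite exprS mulrC dvdp_mul2r.
rewrite add0n Gauss_dvdpl // coprimep_expl //.
by rewrite coprimep_XsubC2 // subr_eq0.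
Qed.

Section RiemannRoch.
Variables (K : closedFieldType) (g : nat) (C : hyperelliptic K g) (L : fieldType).
Variables (kappa : {rmorphism K -> L}) (x y : L).
Local Notation h := (hpol C).
Local Notation f := (fpol C).
Local Notation ev p := (map_poly kappa p).[x].
Local Notation val := (model_value g kappa x y).

Hypothesis M : curve_model C kappa x y.
Hypothesis smooth : affine_nonsingular C.

Let Pl P : on_curve C P -> place (val P).
Proof. exact: model_place. Qed.

Lemma evM p q : ev (p * q) = ev p * ev q.
Proof. by rewrite rmorphM hornerM. Qed.
Lemma evD p q : ev (p + q) = ev p + ev q.
Proof. by rewrite rmorphD hornerD. Qed.
Lemma evB p q : ev (p - q) = ev p - ev q.
Proof. by rewrite rmorphB hornerD hornerN. Qed.
Lemma ev_XsubC c : ev ('X - c%:P) = x - kappa c.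
Proof. by rewrite evB map_polyX map_polyC !horner_ringE. Qed.
Lemma evXn p n : ev (p ^+ n) = ev p ^+ n.
Proof. by rewrite rmorphXn horner_exp. Qed.

Lemma ev_neq0 p : p != 0 -> ev p != 0.
Proof.
apply: contraNneq => e; have [|->//] := model_free M (a := p) (b := 0).
by rewrite rmorph0 horner0 mul0r addr0.
Qed.

Lemma on_curve_involution al be :
  on_curve C (Some (al, be)) -> on_curve C (Some (al, - be - h.[al])).
Proof. by move=> /eqP /= e; apply/eqP; rewrite -e; ring. Qed.

Lemma affine_point_ex al : exists be, on_curve C (Some (al, be)).
Proof.
have [be e] := @solve_monicpoly K 2 (fun i => if i == 0%N then f.[al] else - h.[al]) isT.
exists be => /=; apply/eqP; rewrite e big_ord_recl big_ord1 /= expr0 expr1; ring.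
Qed.

Lemma val_ev al be p : val (Some (al, be)) (ev p) p.[al].
Proof. exact: chart_value_ev. Qed.

Lemma val_y al be : val (Some (al, be)) y be.
Proof. exact: chart_value_y. Qed.

Lemma val_ev_y al be a b : on_curve C (Some (al, be)) ->
  val (Some (al, be)) (ev a + ev b * y) (a.[al] + b.[al] * be).
Proof.
move=> /Pl pl; apply: (placeD pl); first exact: val_ev.
by apply: (placeM pl); [apply: val_ev | apply: val_y].
Qed.

Lemma ramified_affine al be : on_curve C (Some (al, be)) -> be *+ 2 + h.[al] = 0 ->
  puniformizer (val (Some (al, be))) (y - kappa be)
  /\ punit (val (Some (al, be))) ((x - kappa al) / (y - kappa be) ^+ 2).
Proof.
move=> on rm; apply: (ramified_xB (model_eq M) (model_free M) (eqP on) rm).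
by apply/eqP => e; apply: (smooth on).
Qed.

Lemma affine_pord_XsubC al be : on_curve C (Some (al, be)) ->
  pord (val (Some (al, be))) (x - kappa al)
    (if be *+ 2 + h.[al] == 0 then 2 else 1).
Proof.
move=> on; have pl := Pl on; case: eqP => [rm|/eqP ur].
  have [ut uu] := ramified_affine on rm; have [t0 _ _] := ut.
  exists (y - kappa be), ((x - kappa al) / (y - kappa be) ^+ 2).
  by split => //; rewrite -exprnP mulrC divfK // expf_neq0.
apply: (pord_puniformizer pl).
exact: (unramified_xB (model_eq M) (model_free M) (eqP on) ur).
Qed.

Lemma affine_pord_ev al be p : on_curve C (Some (al, be)) -> p != 0 ->
  pord (val (Some (al, be))) (ev p)
    ((if be *+ 2 + h.[al] == 0 then 2 else 1) * (mup al p)%:Z).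
Proof.
move=> on p0; have pl := Pl on; have [q {1}-> q0] := mup_factor al p0.
rewrite evM evXn ev_XsubC -[X in pord _ _ X]addr0.
have ox := affine_pord_XsubC on.
apply: (pordM pl); first exact: (pordXn pl).
case: ox => t [u [ut _ _]]; apply: (pord_punit ut).
by exists q.[al] => //; apply: val_ev.
Qed.

(** Integral closedness of the affine coordinate ring. One root al of [q] is removed at a time:
    regularity makes c + d y vanish at all points above al. Two distinct points give d(al) = 0 by
    subtraction; a single one needs the uniformizer y - be. *)
Lemma regular_affine_dvdp c d q : q != 0 ->
  (forall al be, on_curve C (Some (al, be)) ->
     pregular (val (Some (al, be))) ((ev c + ev d * y) / ev q)) ->
  q %| c /\ q %| d.
Proof.
have [n] := ubnP (size q); elim: n c d q => // n IH c d q sq q0 reg.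
have [s1|s1] := eqVneq (size q) 1%N.
  by move/eqP: s1; rewrite size_poly_eq1 => e; rewrite !(eqp_dvdl _ e) !dvd1p.
have [al /factor_theorem [q1 eq]] := closed_rootP q s1.
have q10 : q1 != 0 by apply: contraNneq q0 => q10; rewrite eq q10 mul0r.
set z := _ / _ in reg.
have Q0 := ev_neq0 q0; have Q10 := ev_neq0 q10.
have ez : ev c + ev d * y = (x - kappa al) * (ev q1 * z).
  by rewrite mulrA [_ * ev q1]mulrC -ev_XsubC -evM -eq /z [RHS]mulrC divfK.
have Vz be : on_curve C (Some (al, be)) -> c.[al] + d.[al] * be = 0.
  move=> on; have pl := Pl on; have [k hk] := reg _ _ on.
  apply: (place_fun pl (val_ev_y c d on)); rewrite ez -(mul0r (q1.[al] * k)).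
  apply: (placeM pl); first exact: chart_value_xB.
  by apply: (placeM pl); first exact: val_ev.
have d0 : d.[al] = 0.
  have [be on] := affine_point_ex al; have on' := on_curve_involution on.
  have [rm|ur] := eqVneq (be *+ 2 + h.[al]) 0; last first.
    apply/eqP; have : d.[al] * (be *+ 2 + h.[al]) == 0.
      have -> : d.[al] * (be *+ 2 + h.[al]) = (c.[al] + d.[al] * be) -
        (c.[al] + d.[al] * (- be - h.[al])) by ring.
      by rewrite !Vz // subrr.
    by rewrite mulf_eq0 (negPf ur) orbF.
  have pl := Pl on; have [[t0 Vt _] [k k0 hk]] := ramified_affine on rm.
  have [|e _ ee] := ev_root kappa x (al := al) (a := c + d * be%:P).
    by rewrite !horner_ringE Vz.
  have [k' hk'] := reg _ _ on.
  apply: (place_fun pl (val_ev al be d)).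
  (* From c + d y = (x - al) e + d (y - be) one gets d (y - be) = (x - al) (q1 z - e). As x - al has
     order 2, a factor y - be is left in d. *)
  have -> : ev d = (x - kappa al) / (y - kappa be) ^+ 2 * (y - kappa be) * (ev q1 * z - ev e).
    apply: (mulIf t0).
    have -> : ev d * (y - kappa be) = (x - kappa al) * (ev q1 * z) - (x - kappa al) * ev e.
      by rewrite -ee -ez evD evM map_polyC hornerC; ring.
    by field.
  have -> : 0 = k * 0 * (q1.[al] * k' - e.[al]) by rewrite mulr0 mul0r.
  apply: (placeM pl); first exact: (placeM pl).
  apply: (placeB pl); last exact: val_ev.
  by apply: (placeM pl) => //; apply: val_ev.
have c0 : c.[al] = 0.
  by have [be on] := affine_point_ex al; have := Vz _ on; rewrite d0 mul0r addr0.
have /factor_theorem [c1 ec] : root c al by rewrite rootE c0.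
have /factor_theorem [d1 ed] : root d al by rewrite rootE d0.
have Xc0 : 'X - al%:P != 0 by rewrite polyXsubC_eq0.
rewrite eq ec ed !dvdp_mul2r //; apply: IH => // [|be be' on].
  by move: sq; rewrite eq mulrC size_XsubC_mul.
have -> : (ev c1 + ev d1 * y) / ev q1 = z; last exact: reg.
have X0 := ev_neq0 Xc0.
by rewrite /z eq ec ed !evM; field; rewrite X0 Q10.
Qed.

(** * The Riemann-Roch space of D_(u,v) - Pinf *)

Variables (u v : {poly K}) (d : nat).
Hypotheses (u_size : size u = d.+1) (u_dvd : u %| v ^+ 2 + h * v - f).

(** The coefficient of D_(u,v) - Pinf. Only ordinates are compared, since [mup] is already 0 when al
    is not a root. *)
Definition model_coeff (P : point K) : int :=
  if P is Some (al, be) then (if be == v.[al] then (mup al u)%:Z else 0) else -1.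

Definition model_RR (z : L) : Prop :=
  forall P, on_curve C P -> exists2 n, pord (val P) z n & 0 <= n + model_coeff P.

Let u0 : u != 0.
Proof. by rewrite -size_poly_gt0 u_size. Qed.

Let U0 : ev u != 0.
Proof. exact: ev_neq0. Qed.

Lemma on_curve_v al : root u al -> on_curve C (Some (al, v.[al])).
Proof.
move=> ra; have := dvdp_trans (_ : 'X - al%:P %| u) u_dvd; rewrite dvdp_XsubCl => /(_ ra).
rewrite dvdp_XsubCl rootE !horner_ringE => /eqP e.
by apply/eqP/subr0_eq; rewrite -[RHS]e.
Qed.

(* At a ramified point a double root of [u] would be a double root of
   [v ^ 2 + h v - f], making the point singular. *)
Lemma ramified_mup al : v.[al] *+ 2 + h.[al] = 0 -> (mup al u <= 1)%N.
Proof.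
move=> rm; have [ra|/mupNroot -> //] := boolP (root u al); have on := on_curve_v ra.
rewrite mup_leq //; apply/negP => dv.
have /dvdpP [q e] := dvdp_trans dv u_dvd.
apply: (smooth on); split=> //.
have := congr1 (fun p => p^`().[al]) e.
rewrite !expr2 derivB derivD !derivM !derivXsubC !horner_ringE subrr => e'.
have -> : h^`().[al] * v.[al] - f^`().[al] =
  v^`().[al] * (v.[al] *+ 2 + h.[al]) + h^`().[al] * v.[al] - f^`().[al].
  by rewrite rm; ring.
transitivity (v^`().[al] * v.[al] + v.[al] * v^`().[al] +
      (h^`().[al] * v.[al] + h.[al] * v^`().[al]) - f^`().[al]); first by ring.
by rewrite e'; ring.
Qed.

(* [y - v] and [y + v + h] are conjugate and their product is divisible by [u]. *)
Lemma conjugate_dvd : exists k, (y - ev v) * (y + ev (v + h)) = ev u * ev k.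
Proof.
have /dvdpP [k e] := u_dvd; exists (- k).
have : ev (v ^+ 2 + h * v - f) = ev (k * u) by rewrite e.
rewrite !(rmorphB, rmorphD, rmorphM, rmorphXn, rmorphN) /= !horner_ringE -(model_eq M) => e'.
rewrite mulrN [ev u * _]mulrC -e'; ring.
Qed.

(** At every affine point the order of u is at least the pole order allowed to z, so u z is regular
    there. *)
Lemma model_RR_numerator c e q : q != 0 ->
  model_RR ((ev c + ev e * y) / ev q) -> q %| u * c /\ q %| u * e.
Proof.
move=> q0 RR; apply: regular_affine_dvdp => // al be on; have pl := Pl on.
have [n on_ n0] := RR _ on; have ou := affine_pord_ev on u0.
have -> : (ev (u * c) + ev (u * e) * y) / ev q = ev u * ((ev c + ev e * y) / ev q).
  by rewrite !evM; field; exact: ev_neq0.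
apply: (pregular_pord_ge0 pl (pordM pl ou on_)).
by move: n0 => /=; case: eqP; case: eqP => _ _; lia.
Qed.

Lemma model_RR_congr a b : model_RR ((ev a + ev b * y) / ev u) -> u %| a - b * (v + h).
Proof.
move=> RR; apply: dvdp_mup => // al.
have [ra|/mupNroot ->] := boolP (root u al); last by rewrite expr0 dvd1p.
have on := on_curve_v ra; have on' := on_curve_involution on.
set z := _ / _ in RR; have ez : ev a + ev b * y = ev u * z by rewrite /z [RHS]mulrC divfK.
(* At a self-conjugate point u has order 2 and z order at least -1, so a + b y vanishes there; a
   simple root of u asks no more. *)
have [rm|ur] := eqVneq (v.[al] *+ 2 + h.[al]) 0.
  have m1 : mup al u = 1%N.
    by apply/eqP; rewrite eqn_leq ramified_mup //= -XsubC_dvd // dvdp_XsubCl.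
  have pl := Pl on; have [n on_ n0] := RR _ on; have ou := affine_pord_ev on u0.
  rewrite m1 expr1 dvdp_XsubCl rootE; apply/eqP.
  have := pordM pl ou on_; rewrite -ez rm eqxx m1 => o.
  have V0 : val (Some (al, v.[al])) (ev a + ev b * y) 0.
    by apply: (place_pord_gt0 pl o); move: n0; rewrite /= eqxx m1; lia.
  have := place_fun pl (val_ev_y a b on) V0.
  have -> : v.[al] = - v.[al] - h.[al].
    by apply/eqP; rewrite -subr_eq0 -[X in _ == X]rm; apply/eqP; ring.
  by rewrite !horner_ringE => <-; ring.
have [->|r0] := eqVneq (a - b * (v + h)) 0; first exact: dvdp0.
set be := - v.[al] - h.[al] in on'.
have ur' : be *+ 2 + h.[al] != 0.
  by rewrite -oppr_eq0; apply: contra ur => /eqP <-; apply/eqP; rewrite /be; ring.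
have nv : be - v.[al] != 0.
  by rewrite -oppr_eq0; apply: contra ur => /eqP <-; apply/eqP; rewrite /be; ring.
have pl := Pl on'; rewrite -mup_geq //.
have or := affine_pord_ev on' r0; have ou := affine_pord_ev on' u0.
have [n on_ n0] := RR _ on'.
have [k ek] := conjugate_dvd.
have Vyv : val (Some (al, be)) (y - ev v) (be - v.[al]).
  by apply: (placeB pl); [apply: val_y|apply: val_ev].
have yv0 := place_neq0 pl Vyv nv.
(* At the conjugate point z is regular and y - v is a unit, so replacing y by -(v + h) in the
   numerator changes the quotient by a regular function. *)
have : pregular (val (Some (al, be))) (ev (a - b * (v + h)) / ev u).
  have -> : ev (a - b * (v + h)) / ev u = z - ev b * ev k / (y - ev v).
    rewrite evB evM; apply: (mulIf U0); rewrite divfK // mulrBl [z * _]mulrC -ez.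
    have -> : ev b * ev k / (y - ev v) * ev u = ev b * (ev u * ev k) / (y - ev v) by field.
    by rewrite -ek; field.
  have [k1 hk1] : pregular (val (Some (al, be))) z.
    apply: (pregular_pord_ge0 pl on_); move: n0 => /=.
    by rewrite -subr_eq0 (negPf nv) addr0.
  exists (k1 - b.[al] * k.[al] / (be - v.[al])).
  apply: (placeB pl) => //; apply: (place_div pl) => //.
  by apply: (placeM pl); apply: val_ev.
move=> /(pord_ge0 pl (pordM pl or (pordV pl ou))).
by rewrite (negPf ur'); lia.
Qed.

(** At infinity a has even order -2 deg a and b y has odd order -2 deg b - (2g+1), so they cannot
    cancel: each is at least the order of u z, hence at least 1 - 2d. *)
Lemma model_RR_size a b : model_RR ((ev a + ev b * y) / ev u) ->
  (size a <= d)%N /\ (size b <= d - g)%N.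
Proof.
move=> RR; have pl := @Pl Pinf isT; have [n on_ n0] := RR Pinf isT.
have ou := infty_pord_ev M u0; rewrite u_size /= in ou.
have ow : pord (val Pinf) (ev a + ev b * y) (n - 2 * d%:Z).
  have -> : ev a + ev b * y = (ev a + ev b * y) / ev u * ev u by rewrite divfK.
  by have := pordM pl on_ ou; congr pord; ring.
have oa : a != 0 -> pord (val Pinf) (ev a) (- 2 * (size a).-1%:Z).
  exact: (infty_pord_ev M).
have ob : b != 0 -> pord (val Pinf) (ev b * y) (- 2 * (size b).-1%:Z - (2 * g + 1)%N%:Z).
  by move=> b0; apply: (pordM pl); [apply: (infty_pord_ev M)|apply: (infty_pord_y M)].
rewrite /= in n0.
have sz (p : {poly K}) : (p == 0) = (size p == 0%N) by rewrite size_poly_eq0.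
have [a0|a0] := eqVneq a 0; have [b0|b0] := eqVneq b 0.
- by rewrite a0 b0 size_poly0.
- move: ow (b0); rewrite a0 rmorph0 horner0 add0r size_poly0 sz => /(pord_uniq pl (ob b0)).
  by move: (size b) => m e m0; split => //; lia.
- move: ow (a0); rewrite b0 rmorph0 horner0 mul0r addr0 size_poly0 sz => /(pord_uniq pl (oa a0)).
  by move: (size a) => m e m0; split => //; lia.
have {}oa := oa a0; have {}ob := ob b0.
move: a0 b0; rewrite !sz; move: (size a) (size b) oa ob => m m' oa ob m0 m'0.
have [lt|ge] := ltP (- 2 * m.-1%:Z) (- 2 * m'.-1%:Z - (2 * g + 1)%N%:Z).
  have := pord_uniq pl ow (pordD pl oa ob lt); lia.
have lt : - 2 * m'.-1%:Z - (2 * g + 1)%N%:Z < - 2 * m.-1%:Z by lia.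
have := pord_uniq pl ow; rewrite addrC => /(_ _ (pordD pl ob oa lt)); lia.
Qed.

Lemma model_RR_intro a b : (g < d)%N -> (a != 0) || (b != 0) ->
  u %| a - b * (v + h) -> (size a <= d)%N -> (size b <= d - g)%N ->
  model_RR ((ev a + ev b * y) / ev u).
Proof.
move=> gd ab0 /dvdpP [k ek] sa sb P on; have pl := Pl on.
set z := _ / _.
have [m om] := model_pord M smooth on ab0.
case: P on pl om => [[al be]|] on pl om.
  have ou := affine_pord_ev on u0.
  exists (m - (if be *+ 2 + h.[al] == 0 then 2 else 1) * (mup al u)%:Z).
    by apply: (pordM pl) => //; apply: (pordV pl).
  have [k' ek'] := conjugate_dvd.
  have [nv|nv] := eqVneq be v.[al]; last first.
    have Vyv : val (Some (al, be)) (y - ev v) (be - v.[al]).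
      by apply: (placeB pl); [apply: val_y|apply: val_ev].
    have nv' : be - v.[al] != 0 by rewrite subr_eq0.
    have yv0 := place_neq0 pl Vyv nv'.
    rewrite /model_coeff (negPf nv) addr0; apply: (pord_ge0 pl (pordM pl om (pordV pl ou))).
    have -> : (ev a + ev b * y) / ev u = ev k + ev b * ev k' / (y - ev v).
      have := congr1 (fun p => ev p) ek; rewrite /= evB !evM => /(canRL (subrK _)) ->.
      apply: (mulIf U0); rewrite divfK // mulrDl.
      have -> : ev b * ev k' / (y - ev v) * ev u = ev b * (ev u * ev k') / (y - ev v) by field.
      by rewrite -ek'; field.
    exists (k.[al] + b.[al] * k'.[al] / (be - v.[al])).
    apply: (placeD pl); first exact: val_ev.
    by apply: (place_div pl) => //; apply: (placeM pl); apply: val_ev.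
  rewrite /model_coeff nv eqxx.
  have m0 : 0 <= m by apply: (pord_ge0 pl om); eexists; apply: val_ev_y.
  (* When the point is self-conjugate u has order twice [mup]. As [mup] is at most 1, one extra zero
     suffices, and it comes from a + b v = b (2 v + h) = 0 at al. *)
  case: eqP => [rm|_]; last by lia.
  have := ramified_mup rm; case em: (mup al u) => [|[|//]] _; first by lia.
  have : 0 < m; last by lia.
  apply: (pord_gt0 pl om); have := val_ev_y a b on; congr val.
  have ra : root u al by rewrite -dvdp_XsubCl XsubC_dvd // em.
  have := congr1 (fun p => p.[al]) ek; rewrite !horner_ringE (eqP ra) mulr0 => e.
  by rewrite nv -[RHS]e -[LHS]subr0 -(mulr0 b.[al]) -rm; ring.
have x0 := model_x_neq0 M.
have ou := infty_pord_ev M u0; have oz := pordM pl om (pordV pl ou).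
exists (m - - 2 * (size u).-1%:Z) => //=.
rewrite subr_ge0 -gtz0_ge1.
apply: (pord_gt0 pl oz).
(* After division by x^d the denominator has residue lead(u), while the numerator has residue 0: a
   has degree below d, and s vanishes at infinity. *)
have -> : (ev a + ev b * y) / ev u =
    (ev a / x ^+ d + ev b / x ^+ (d - g.+1) * (y / x ^+ g.+1)) / (ev u / x ^+ d).
  have -> : x ^+ d = x ^+ (d - g.+1) * x ^+ g.+1 by rewrite -exprD subnK.
  by field; rewrite U0 !expf_neq0.
have -> : 0 = (a`_d + b`_(d - g.+1) * 0) / u`_d :> K.
  by rewrite mulr0 addr0 nth_default // mul0r.
apply: (place_div pl).
- apply: (placeD pl); first by apply: (infty_value_rev M); apply: leqW.
  apply: (placeM pl); first by apply: (infty_value_rev M); rewrite subnSK.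
  by have [[_ Vs _] _] := infty_puniformizer M.
- by apply: (infty_value_rev M); rewrite u_size.
by have := u0; rewrite -lead_coef_eq0 lead_coefE u_size.
Qed.

End RiemannRoch.

(** * Rationality *)

Section RationalFunctions.
Variables (F : fieldType) (K : closedFieldType) (phi : {rmorphism F -> K}).
Variables (g : nat) (C : hyperelliptic F g) (L : fieldType).
Local Notation CK := (base_change phi C).
Local Notation h := (hpol C).
Local Notation f := (fpol C).
Local Notation "p ^phi" := (map_poly phi p) (at level 2, format "p ^phi").
Variables (kappa : {rmorphism K -> L}) (x y : L).
Local Notation ev p := (map_poly kappa p).[x].
Local Notation ev2 p := (map_poly (map_poly kappa) (map_poly (map_poly phi) p)).[x, y].
Hypothesis M : curve_model CK kappa x y.

Definition model_rational (z : L) : Prop :=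
  exists p q : {poly {poly F}}, ev2 q != 0 /\ z = ev2 p / ev2 q.

Lemma ev2_const (p : {poly F}) : ev2 (map_poly polyC p) = ev p^phi.
Proof.
rewrite -!map_poly_comp.
rewrite (eq_map_poly (g := polyC \o (kappa \o phi))); last first.
  by move=> c /=; rewrite !map_polyC.
by rewrite (map_poly_comp polyC (kappa \o phi)) horner_map /= hornerC.
Qed.

Lemma ev2_reduce (p : {poly {poly F}}) :
  exists a b : {poly F}, ev2 p = ev a^phi + ev b^phi * y.
Proof.
have [a [b ab]] := curve_reduce h f p; exists a, b.
have := ab _ (kappa \o phi) x y; rewrite !map_poly_comp /=.
rewrite (eq_map_poly (g := map_poly kappa \o map_poly phi)); last first.
  by move=> c /=; rewrite map_poly_comp.
by rewrite map_poly_comp; apply; exact: model_eq M.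
Qed.

(** The denominator a' + b' y is cleared with its conjugate a' - b' h - b' y; the norm [N] is a
    polynomial in x over F. *)
Lemma model_rational_normal z : model_rational z -> exists c e q : {poly F},
  q != 0 /\ z = (ev c^phi + ev e^phi * y) / ev q^phi.
Proof.
move=> [p [q [q0 ->]]]; have [a [b ->]] := ev2_reduce p.
have [a' [b' eq]] := ev2_reduce q; rewrite eq in q0 *.
have my : y ^+ 2 = ev f^phi - ev h^phi * y.
  by rewrite -(model_eq M) addrK.
pose N := a' ^+ 2 - a' * b' * h - b' ^+ 2 * f.
have eN : ev N^phi = (ev a'^phi + ev b'^phi * y) *
    (ev a'^phi - ev b'^phi * ev h^phi - ev b'^phi * y).
  rewrite /N !(rmorphB, rmorphM, rmorphXn) /= !horner_ringE.
  rewrite [RHS](_ : _ = ev a'^phi ^+ 2 - ev a'^phi * ev b'^phi * ev h^phi -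
    ev b'^phi ^+ 2 * (ev h^phi * y + y ^+ 2)); last by ring.
  by rewrite my; ring.
have c0 : ev a'^phi - ev b'^phi * ev h^phi - ev b'^phi * y != 0.
  apply/eqP => e; have := model_free M (a := a'^phi - b'^phi * h^phi) (b := - b'^phi).
  rewrite !(rmorphB, rmorphM, rmorphN) /= !horner_ringE mulNr e => -[//|ea /eqP].
  rewrite oppr_eq0 map_poly_eq0 => /eqP b0; move: q0 ea.
  rewrite b0 rmorph0 mul0r subr0 => q0 /eqP; rewrite map_poly_eq0 => /eqP a0.
  by move: q0; rewrite a0 !rmorph0 !horner0 mul0r addr0 eqxx.
exists (a * (a' - b' * h) - b * b' * f), (b * a' - a * b'), N.
have N0 : ev N^phi != 0 by rewrite eN mulf_neq0.
split; first by apply: contraNneq N0 => ->; rewrite !rmorph0 horner0.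
apply/eqP; rewrite eqr_div // eN; apply/eqP.
rewrite !(rmorphB, rmorphM, rmorphXn) /= !horner_ringE.
rewrite mulrCA [RHS]mulrC; congr (_ * _).
rewrite [LHS](_ : _ = ev a^phi * (ev a'^phi - ev b'^phi * ev h^phi) +
  (ev b^phi * ev a'^phi - ev b^phi * ev b'^phi * ev h^phi - ev a^phi * ev b'^phi) * y
  - ev b^phi * ev b'^phi * y ^+ 2); last by ring.
by rewrite my; ring.
Qed.

Lemma model_rational_intro (a b u : {poly F}) : u != 0 ->
  model_rational ((ev a^phi + ev b^phi * y) / ev u^phi).
Proof.
move=> u0.
exists (map_poly polyC a + map_poly polyC b * 'X%:P), (map_poly polyC u).
rewrite !(rmorphD, rmorphM) /= !horner_ringE !ev2_const (ev_neq0 M) ?map_poly_eq0 //.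
by rewrite !map_polyC /= !map_polyX !horner_ringE.
Qed.

Hypothesis smooth : affine_nonsingular CK.
Variables (u v : {poly F}) (d : nat).
Hypotheses (u_size : size u = d.+1) (u_dvd : u %| v ^+ 2 + h * v - f).
Hypothesis lt_gd : (g < d)%N.

Definition RR_pair (a b : {poly F}) : Prop :=
  [/\ u %| a - b * (v + h), (size a <= d)%N & (size b <= d - g)%N].

Definition RR_fun (a b : {poly F}) : L := (ev a^phi + ev b^phi * y) / ev u^phi.

Let u0 : u != 0. Proof. by rewrite -size_poly_gt0 u_size. Qed.
Let uK_size : size u^phi = d.+1. Proof. by rewrite size_map_poly. Qed.
Let uK_dvd : u^phi %| v^phi ^+ 2 + hpol CK * v^phi - fpol CK.
Proof. by rewrite /= -rmorphM -rmorphXn -rmorphD -rmorphB dvdp_map. Qed.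

(** Descent to F: [q] divides u c and u e over K, hence over F, and the quotients are the required a
    and b. *)
Lemma model_RR_pair z : model_rational z ->
  model_RR CK kappa x y u^phi v^phi z ->
  exists a b, RR_pair a b /\ z = RR_fun a b.
Proof.
move=> /model_rational_normal [c [e [q [q0 ->]]]] RR.
have qK0 : q^phi != 0 by rewrite map_poly_eq0.
have := model_RR_numerator M smooth uK_size uK_dvd qK0 RR.
rewrite -!rmorphM !dvdp_map => -[/dvdpP[a ea] /dvdpP[b eb]].
have ez : (ev c^phi + ev e^phi * y) / ev q^phi = RR_fun a b.
  have Q0 := ev_neq0 M qK0; have U0 : ev u^phi != 0 by rewrite (ev_neq0 M) ?map_poly_eq0.
  have evMphi (p r : {poly F}) : ev (p * r)^phi = ev p^phi * ev r^phi.
    by rewrite !rmorphM hornerM.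
  apply/eqP; rewrite /RR_fun eqr_div //; apply/eqP.
  transitivity (ev (u * c)^phi + ev (u * e)^phi * y); first by rewrite !evMphi; ring.
  by rewrite ea eb !evMphi; ring.
rewrite ez in RR *; exists a, b; split=> //; split.
- have := model_RR_congr M smooth uK_size uK_dvd RR.
  by rewrite -rmorphD -rmorphM -rmorphB dvdp_map.
- by have [] := model_RR_size M uK_size uK_dvd RR; rewrite size_map_poly.
by have [] := model_RR_size M uK_size uK_dvd RR; rewrite !size_map_poly.
Qed.

Lemma RR_fun_model a b : RR_pair a b -> (a != 0) || (b != 0) ->
  model_RR CK kappa x y u^phi v^phi (RR_fun a b).
Proof.
move=> [dv sa sb] ab0; apply: (model_RR_intro M smooth uK_size uK_dvd lt_gd).
- by rewrite !map_poly_eq0.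
- by rewrite /= -rmorphD -rmorphM -rmorphB dvdp_map.
- by rewrite size_map_poly.
by rewrite size_map_poly.
Qed.

Lemma RR_fun_value al be a b : on_curve C (Some (al, be)) -> u.[al] != 0 ->
  model_value g kappa x y (Some (phi al, phi be)) (RR_fun a b)
    (phi ((a.[al] + b.[al] * be) / u.[al])).
Proof.
move=> on ua0.
have onK : on_curve CK (Some (phi al, phi be)).
  by move/eqP: on => /= on; rewrite !horner_map -rmorphXn -rmorphM -rmorphD on.
have pl := model_place M onK.
have := val_ev_y M (map_poly phi a) (map_poly phi b) onK.
rewrite fmorph_div rmorphD rmorphM -!horner_map => V.
apply: (place_div pl V); first exact: val_ev.
by rewrite horner_map fmorph_eq0.
Qed.

Lemma mumford_coeff P :
  coeff P (mumford_divisor phi u v - << (Pinf : point K) >>)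
  = model_coeff u^phi v^phi P.
Proof.
rewrite coeffB raddf_sum coeffU mul1r /=.
under eq_bigr => c _ do rewrite coeffU.
case: P => [[al be]|] /=; last first.
  by rewrite big1 ?sub0r ?eqxx // => c _; rewrite mulr0.
rewrite subr0.
have uKN0 : u^phi != 0 by rewrite map_poly_eq0.
have mem_roots c : (c \in poly_roots u^phi) = root u^phi c.
  rewrite /poly_roots mem_undup; case: closed_field_poly_normal => r /= er.
  by rewrite [in RHS]er rootZ ?lead_coef_eq0 // root_prod_XsubC.
have [ra|nra] := boolP (al \in poly_roots u^phi).
  rewrite (bigD1_seq al) ?undup_uniq //= big1 ?addr0; last first.
    move=> c ca; rewrite (_ : _ == _ = false) ?mulr0 //.
    by apply: contraNF ca => /eqP [-> _].
  rewrite (_ : (_ == _) = (be == v^phi.[al])); last first.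
    by apply/eqP/eqP => [[->]|->].
  by case: eqP; rewrite ?mulr1 ?mulr0.
rewrite big1_seq; first by rewrite mupNroot -?mem_roots // if_same.
move=> c /andP[_ cr]; rewrite (_ : _ == _ = false) ?mulr0 //.
by apply: contraNF nra => /eqP [<- _].
Qed.

End RationalFunctions.

(** * Return to the concrete function field *)

Section RRspace.
Variables (F : fieldType) (K : closedFieldType) (phi : {rmorphism F -> K}).
Variables (g : nat) (C : hyperelliptic F g).
Local Notation CK := (base_change phi C).
Hypothesis smooth : affine_nonsingular CK.
Variables (u v : {poly F}) (d : nat).
Hypotheses (u_size : size u = d.+1) (u_dvd : u %| v ^+ 2 + hpol C * v - fpol C).
Hypothesis lt_gd : (g < d)%N.

Definition RR_funfield (a b : {poly F}) : funfield CK :=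
  RR_fun phi (constF CK) (xF CK) (yF CK) u a b.

Lemma RRspaceP (z : funfield CK) :
  RRspace (mumford_divisor phi u v - << (Pinf : point K) >>) z <->
  exists a b, RR_pair C u v d a b /\ z = RR_funfield a b.
Proof.
have M := funfield_model CK.
have u0 : u != 0 by rewrite -size_poly_gt0 u_size.
split=> [[rat [->|RR]]|[a [b [ab ->]]]].
- exists 0, 0; split; first by split; rewrite ?mul0r ?subr0 ?size_poly0 ?dvdp0.
  by rewrite /RR_funfield /RR_fun !rmorph0 !horner0 mul0r addr0 mul0r.
- apply: (model_RR_pair M smooth u_size u_dvd); first exact: rat.
  move=> P on; have [n /has_ordE on' n0] := RR P on.
  by exists n => //; rewrite -(mumford_coeff phi v u_size).
split; first exact: (model_rational_intro M).
have [ab0|ab0] := boolP ((a != 0) || (b != 0)); [right|left].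
  move=> P on; have [n on' n0] := RR_fun_model M smooth u_size u_dvd lt_gd ab ab0 on.
  by exists n; [apply/has_ordE|rewrite (mumford_coeff phi v u_size)].
move: ab0; rewrite negb_or !negbK => /andP[/eqP-> /eqP->].
by rewrite /RR_funfield /RR_fun !rmorph0 !horner0 mul0r addr0 mul0r.
Qed.

Lemma RR_funfield_value al be a b : on_curve C (Some (al, be)) -> u.[al] != 0 ->
  has_value (Some (phi al, phi be)) (RR_funfield a b)
    (phi ((a.[al] + b.[al] * be) / u.[al])).
Proof. by move=> on ua; apply/has_valueE; apply: (RR_fun_value (funfield_model CK)). Qed.

Lemma has_value_fun al be (z : funfield CK) c c' : on_curve C (Some (al, be)) ->
  has_value (Some (phi al, phi be)) z c -> has_value (Some (phi al, phi be)) z c' -> c = c'.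
Proof.
move=> on /has_valueE V /has_valueE V'.
have onK : on_curve CK (Some (phi al, phi be)).
  by move/eqP: on => /= on; rewrite !horner_map -rmorphXn -rmorphM -rmorphD on.
exact: (place_fun (model_place (funfield_model CK) onK) V V').
Qed.

End RRspace.

(** * The evaluation points *)

Section EvaluationPoints.
Variables (F : fieldType) (g : nat) (C : hyperelliptic F g) (t : nat).
Local Notation h := (hpol C).

(** What the equality of divisors implies for the points: distinct abscissas, no self-conjugate
    point, and [R] running through exactly the [P i] and their conjugates. *)
Record evaluation_points (R : 'I_(2 * t) -> point F) (X Y : 'I_t -> F) : Prop :=
  EvaluationPoints {
    ep_inj : injective X;
    ep_on : forall i, on_curve C (Some (X i, Y i));
    ep_neq : forall i, Y i != - Y i - h.[X i];
    ep_point : forall i, exists j, R j = Some (X i, Y i);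
    ep_conj : forall i, exists j, R j = Some (X i, - Y i - h.[X i]);
    ep_cover : forall j, exists i,
      R j = Some (X i, Y i) \/ R j = Some (X i, - Y i - h.[X i])
  }.

Variables (K : closedFieldType) (phi : {rmorphism F -> K}).
Variables (P : 'I_t -> point F) (R : 'I_(2 * t) -> point F).
Hypothesis P_on : forall i, on_curve C (P i).
Hypothesis R_inj : injective R.
Hypothesis eq_D : \sum_(j < 2 * t) point_divisor phi (R j) =
  \sum_(i < t) (point_divisor phi (P i) + point_divisor phi (involution C (P i))).

Lemma map_point_inj : injective (map_point phi).
Proof. by move=> [[a b]|] [[c d]|] //= [/fmorph_inj -> /fmorph_inj ->]. Qed.

Let mult i Q : nat := (P i == Q) + (involution C (P i) == Q).

Let count_points Q : (\sum_(j < 2 * t) (R j == Q) = \sum_(i < t) mult i Q)%N.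
Proof.
have cf S : coeff (map_point phi Q) (point_divisor phi S) = (S == Q)%:R.
  by rewrite coeffU mul1r (inj_eq map_point_inj).
have := congr1 (coeff (map_point phi Q)) eq_D.
rewrite !raddf_sum /=; under eq_bigr => j _ do rewrite cf.
under [X in _ = X -> _]eq_bigr => i _ do rewrite coeffD !cf -natrD.
by rewrite -!natr_sum => /eqP; rewrite eqr_nat => /eqP.
Qed.

(** By injectivity of [R] the left-hand divisor is reduced, so no point can occur twice among the
    [P i] and their conjugates. *)
Let sum_mult_le1 Q : (\sum_(i < t) mult i Q <= 1)%N.
Proof.
rewrite -count_points; case: (pickP (fun j => R j == Q)) => [j /eqP jQ|no].
  rewrite (bigD1 j) //= big1 ?addn0 ?leq_b1 // => k kj.
  by rewrite -jQ (inj_eq R_inj) (negPf kj).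
by rewrite big1 // => j _; rewrite no.
Qed.

Let mult_le1 i Q : (mult i Q <= 1)%N.
Proof. by apply: leq_trans (sum_mult_le1 Q); rewrite (bigD1 i) //= leq_addr. Qed.

Let mult_le2 i k Q : i != k -> (mult i Q + mult k Q <= 1)%N.
Proof.
move=> ik; apply: leq_trans (sum_mult_le1 Q).
by rewrite (bigD1 i) //= leq_add2l (bigD1 k) 1?eq_sym //= leq_addr.
Qed.

(** The point at infinity is its own conjugate and would be counted twice. *)
Let P_affine i : P i = Some (xcoord (P i), (center (P i)).2).
Proof.
by have := mult_le1 i Pinf; rewrite /mult; case: (P i) => [[a b]|].
Qed.

Let covered Q i : (0 < mult i Q)%N -> exists j, R j = Q.
Proof.
move=> m0; case: (pickP (fun j => R j == Q)) => [j /eqP jQ|no]; first by exists j.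
have := count_points Q; rewrite big1 => [|j _]; last by rewrite no.
by rewrite (bigD1 i) //=; lia.
Qed.

Lemma divisor_evaluation_points :
  evaluation_points R (fun i => xcoord (P i)) (fun i => (center (P i)).2).
Proof.
have iP i : Some (xcoord (P i), - (center (P i)).2 - h.[xcoord (P i)]) = involution C (P i).
  by rewrite [in RHS]P_affine.
split=> [i k eqX|i|i|i|i|j].
- apply: contraTeq isT => ik.
  (* Equal abscissas mean equal or conjugate points, and either case counts [P i] in two different
     summands. *)
  have : P k = P i \/ involution C (P k) = P i.
    have := P_on i; have := P_on k; move: eqX.
    rewrite [P i]P_affine [P k]P_affine /=; set x := xcoord (P k) => <-.
    set yk := (center (P k)).2; set yi := (center (P i)).2 => /eqP ek /eqP ei.
    have /eqP : (yk - yi) * (- yk - h.[xcoord (P i)] - yi) = 0.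
      have -> : (yk - yi) * (- yk - h.[xcoord (P i)] - yi) =
        (yi ^+ 2 + h.[xcoord (P i)] * yi) - (yk ^+ 2 + h.[xcoord (P i)] * yk) by ring.
      by rewrite ek ei subrr.
    by rewrite mulf_eq0 !subr_eq0 => /orP[/eqP->|/eqP->]; [left|right].
  have := mult_le2 (P i) ik; rewrite /mult eqxx => m2.
  by case=> e; move: m2; rewrite e eqxx /=; lia.
- by rewrite -P_affine.
- have := mult_le1 i (P i); rewrite /mult eqxx; apply: contraTneq => e.
  by rewrite -iP -e -P_affine eqxx.
- by rewrite -P_affine; apply: (covered (i := i)); rewrite /mult eqxx.
- by rewrite iP; apply: (covered (i := i)); rewrite /mult eqxx addn1.
have : (0 < \sum_(i < t) mult i (R j))%N.
  by rewrite -count_points (bigD1 j) //= eqxx.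
rewrite lt0n sum_nat_eq0 negb_forall => /existsP[i /=].
rewrite addn_eq0 !eqb0 negb_and !negbK => p.
by exists i; rewrite iP -P_affine; case/orP: p => /eqP ->; [left|right].
Qed.

End EvaluationPoints.

(** * The codes *)

(** Repetitions in [s] matter: two conjugate evaluation points share their abscissa. *)
Lemma prod_XsubC_dvdp (F : fieldType) (s : seq F) (p : {poly F}) : p != 0 ->
  (forall c, (count_mem c s <= mup c p)%N) -> \prod_(c <- s) ('X - c%:P) %| p.
Proof.
elim: s p => [|c s IH] p p0 sp; first by rewrite big_nil dvd1p.
have /factor_theorem [q eq] : root p c.
  by rewrite -dvdp_XsubCl XsubC_dvd //; apply: leq_trans (sp c); rewrite /= eqxx.
have q0 : q != 0 by apply: contraNneq p0 => q0; rewrite eq q0 mul0r.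
rewrite big_cons eq mulrC dvdp_mul2r ?polyXsubC_eq0 //; apply: IH => // d.
have := sp d; rewrite eq mulrC mupM ?polyXsubC_eq0 // -['X - c%:P]expr1 mup_XsubCX /=.
by case: (c == d); rewrite ?add1n ?add0n.
Qed.

Lemma RR_pair_uniq (F : fieldType) g (C : hyperelliptic F g) (u v : {poly F}) d a b :
  size u = d.+1 -> RR_pair C u v d a b -> a = (b * (v + hpol C)) %% u.
Proof.
move=> su [dv sa _]; rewrite -[LHS](@modp_small _ _ u) ?su //; apply/subr0_eq.
by rewrite -modpN -modpD; apply/eqP.
Qed.

(** For b nonzero the norm is b^2 times the value of [curve_poly] at -a/b, and that polynomial has
    no root in F(x). *)
Lemma norm_neq0 (F : fieldType) g (C : hyperelliptic F g) (a b : {poly F}) :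
  (a != 0) || (b != 0) -> a ^+ 2 - a * b * hpol C - b ^+ 2 * fpol C != 0.
Proof.
have [->|b0 _] := eqVneq b 0.
  by rewrite orbF expr0n /= mulr0 !mul0r !subr0 expf_eq0.
apply/negP => /eqP N0; have /negP := curve_poly_noroot C
  (- (FracField.tofrac a / FracField.tofrac b)); apply.
have B0 : FracField.tofrac b != 0 by rewrite tofrac_eq0.
have clear (L : fieldType) (n m k l : L) : m != 0 ->
  ((- (n / m)) ^+ 2 + k * - (n / m) - l) * (m * m) = n * n - n * m * k - m * m * l.
  by move=> m0; field.
rewrite rootE /curve_poly !horner_ringE.
apply/eqP; apply: (mulIf (expf_neq0 2 B0)); rewrite mul0r.
transitivity (FracField.tofrac (a ^+ 2 - a * b * hpol C - b ^+ 2 * fpol C)).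
  by rewrite (expr2 (FracField.tofrac b)) clear // !expr2 !(tofracD, tofracN, tofracM).
by rewrite N0 rmorph0.
Qed.

Section Code.
Variables (F : finFieldType) (g : nat) (C : hyperelliptic F g) (t : nat).
Variables (R : 'I_(2 * t) -> point F) (X Y : 'I_t -> F).
Hypotheses (EP : evaluation_points C R X Y) (R_inj : injective R).
Local Notation h := (hpol C).
Local Notation f := (fpol C).
Local Notation xs j := (center (R j)).1.
Local Notation ys j := (center (R j)).2.

Lemma ep_affine j : R j = Some (xs j, ys j).
Proof. by have [i [->|->]] := ep_cover EP j. Qed.

Lemma ep_xs j : exists i, xs j = X i.
Proof. by have [i [->|->]] := ep_cover EP j; exists i. Qed.

Lemma ep_R_on j : on_curve C (Some (xs j, ys j)).
Proof.
have [i [->|->]] := ep_cover EP j; have := ep_on EP i => //= /eqP <-.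
by apply/eqP; ring.
Qed.

(** Subtracting the values at conjugate points gives b(X i) (2 Y i + h(X i)) = 0. Leaving [a]
    arbitrary allows differences between functions of two codes, where the second conclusion is
    used. *)
Lemma ep_vanish (a b : {poly F}) : (size b <= t)%N ->
  (forall j, a.[xs j] + b.[xs j] * ys j = 0) ->
  b = 0 /\ \prod_(i < t) ('X - (X i)%:P) %| a.
Proof.
move=> sb ab0.
have b0 i : b.[X i] = 0.
  have [j Rj] := ep_point EP i; have [j' Rj'] := ep_conj EP i.
  have := ab0 j; have := ab0 j'; rewrite Rj Rj' /= => e' e.
  have /eqP : b.[X i] * (Y i - (- Y i - h.[X i])) = 0.
    rewrite mulrBr -[LHS](_ : (a.[X i] + b.[X i] * Y i)
      - (a.[X i] + b.[X i] * (- Y i - h.[X i])) = _).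
      by rewrite e e' subrr.
    by ring.
  by rewrite mulf_eq0 subr_eq0 (negPf (ep_neq EP i)) orbF => /eqP.
have prodE : \prod_(i < t) ('X - (X i)%:P) = \prod_(c <- [seq X i | i <- enum 'I_t]) ('X - c%:P).
  by rewrite big_map big_enum.
have Xuniq : uniq_roots [seq X i | i <- enum 'I_t].
  by rewrite uniq_rootsE (map_inj_uniq (ep_inj EP)) enum_uniq.
have bz : b = 0.
  apply/eqP; apply: contraT => nb.
  have := max_poly_roots nb _ _ ; move/(_ [seq X i | i <- enum 'I_t]).
  rewrite size_map size_enum_ord ltnNge sb /=; apply.
    by apply/allP => c /mapP [i _ ->]; rewrite rootE b0.
  by rewrite (map_inj_uniq (ep_inj EP)) enum_uniq.
split=> //; rewrite prodE; apply: uniq_roots_dvdp => //.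
apply/allP => c /mapP [i _ ->]; rewrite rootE.
have [j Rj] := ep_point EP i; have := ab0 j.
by rewrite Rj bz horner0 mul0r addr0 => ->.
Qed.

Section OneCode.
Variables (u v : {poly F}).
Hypothesis u_size : size u = (g + t).+1.
Hypothesis u_dvd : u %| v ^+ 2 + h * v - f.
Hypothesis u_X : forall i, u.[X i] != 0.

Let u0 : u != 0. Proof. by rewrite -size_poly_gt0 u_size. Qed.

Lemma u_xs j : u.[xs j] != 0.
Proof. by have [i ->] := ep_xs j. Qed.

(* A zero of [a + b y] at both points above [c] is a double zero of the norm
   [a ^ 2 - a b h - b ^ 2 f]. *)
Lemma card_zeros a b : (0 < t)%N -> RR_pair C u v (g + t) a b -> (a != 0) || (b != 0) ->
  (#|[set j | (a.[xs j] + b.[xs j] * ys j)%R == 0%R]| < g + t)%N.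
Proof.
move=> t0 [dv sa sb] ab0; set S := [set j | _].
set N := a ^+ 2 - a * b * h - b ^+ 2 * f.
have N0 : N != 0 by apply: norm_neq0.
(* The bound comes from b^2 f, of degree at most 2 (t - 1) + 2g + 1. *)
have szN : (size N <= (g + t).*2)%N.
  have S1 := size_polyMleq a a; have S2 := size_polyMleq b b.
  have S3 := size_polyMleq a b; have S4 := size_polyMleq (a * b) h.
  have S5 := size_polyMleq (b * b) f; have S6 := size_hpol C; have S7 := size_fpol C.
  apply: leq_trans (size_polyD _ _) _; rewrite geq_max size_polyN !expr2; apply/andP; split.
    apply: leq_trans (size_polyD _ _) _; rewrite geq_max size_polyN; apply/andP; split.
      by apply: leq_trans S1 _; lia.
    apply: leq_trans S4 _; lia.
  by apply: leq_trans S5 _; rewrite S7; lia.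
have uN : u %| N.
  (* [N] is (a + b y) (a - b h - b y); substituting v for y changes it by a multiple of v^2 + h v -
     f. *)
  have -> : N = (a - b * (v + h)) * (a + b * v) + b ^+ 2 * (v ^+ 2 + h * v - f).
    by rewrite /N; ring.
  by apply: dvdp_add; [apply: dvdp_mulr|apply: dvdp_mull].
have /dvdpP [N1 eN] := uN; rewrite mulrC in eN.
have N10 : N1 != 0 by apply: contraNneq N0 => e; rewrite eN e mulr0.
pose s := [seq xs j | j <- enum S].
have zeroN j : j \in S -> root N (xs j).
  rewrite inE => /eqP e; rewrite rootE /N !horner_ringE.
  have /eqP <- := ep_R_on j.
  set x := xs j in e *; set y := ys j in e *.
  have -> : a.[x] = - (b.[x] * y) by apply/eqP; rewrite -addr_eq0 e.
  by apply/eqP; ring.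
have sN : \prod_(c <- s) ('X - c%:P) %| N1.
  apply: prod_XsubC_dvdp => // c.
  have [cs|/count_memPn -> //] := boolP (c \in s).
  (* u has no root at an evaluation abscissa, so all these zeros of the norm survive in the
     cofactor. *)
  have muN : mup c N1 = mup c N.
    rewrite eN mupMr //; have /mapP [j _ ->] := cs.
    by rewrite rootE u_xs.
  rewrite muN count_map -size_filter.
  set l := [seq j <- enum S | _].
  have lS j : j \in l -> j \in S /\ xs j = c.
    by rewrite mem_filter mem_enum /= => /andP[/eqP -> ->].
  have ul : uniq l by rewrite filter_uniq ?enum_uniq.
  clearbody l; have l_le2 : (size l <= 2)%N.
    have /mapP [j0 _ ec] := cs; have [i ei] := ep_xs j0.
    rewrite -(size_map R); apply: (@uniq_leq_size _ _
      [:: Some (X i, Y i) : point F; Some (X i, - Y i - h.[X i])]).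
      by rewrite map_inj_uniq.
    move=> Q /mapP [j /lS [_ ej] ->].
    have [k [Rk|Rk]] := ep_cover EP j; move: ej; rewrite Rk /= ec ei => /(ep_inj EP) ->;
      by rewrite !inE eqxx ?orbT.
  case: l lS ul l_le2 => [//|j [|j' [|//]]] lS ul _ /=.
    have [jS <-] := lS j (mem_head _ _).
    by rewrite -XsubC_dvd // dvdp_XsubCl zeroN.
  have [jS ej] := lS j (mem_head _ _).
  have [j'S ej'] : j' \in S /\ xs j' = c by apply: lS; rewrite !inE eqxx orbT.
  have nys : ys j != ys j'.
    move: ul; rewrite /= inE andbT; apply: contraNneq => e.
    by apply/eqP/R_inj; rewrite (ep_affine j) (ep_affine j') e ej ej'.
  move: jS j'S; rewrite !inE ej ej' => /eqP e /eqP e'.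
  have b0 : b.[c] = 0.
    have /eqP : b.[c] * (ys j - ys j') = 0.
      have -> : b.[c] * (ys j - ys j') = (a.[c] + b.[c] * ys j) - (a.[c] + b.[c] * ys j') by ring.
      by rewrite e e' subrr.
    by rewrite mulf_eq0 subr_eq0 (negPf nys) orbF => /eqP.
  have a0 : a.[c] = 0 by move: e; rewrite b0 mul0r addr0.
  have /factor_theorem [a1 ea] : root a c by rewrite rootE a0.
  have /factor_theorem [b1 eb] : root b c by rewrite rootE b0.
  rewrite mup_geq //; apply/dvdpP; exists (a1 ^+ 2 - a1 * b1 * h - b1 ^+ 2 * f).
  by rewrite /N ea eb; ring.
(* Degree count: at most (2 (g + t) - 1) - (g + t) zeros. *)
have := dvdp_leq N10 sN; rewrite size_prod_XsubC size_map -cardE => le1.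
apply: leq_trans le1 _; rewrite -(leq_add2l (g + t)) addnn.
by move: szN; rewrite eN size_mul // u_size addSn.
Qed.

(** The message [r] lists the coefficients of b. Taking a as a remainder keeps the map linear, so
    the code is a linear image. *)
Definition encode (r : 'rV[F]_t) : 'rV[F]_(2 * t) :=
  \row_j ((((rVpoly r * (v + h)) %% u).[xs j] + (rVpoly r).[xs j] * ys j) / u.[xs j]).

Fact encode_is_linear : linear encode.
Proof.
move=> k r s; apply/rowP => j; rewrite !mxE.
have -> : rVpoly (k *: r + s) = k *: rVpoly r + rVpoly s by exact: linearP.
by rewrite [_ * (v + h)]mulrDl modpD -scalerAl modpZl !hornerD !hornerZ; ring.
Qed.
HB.instance Definition _ := GRing.isLinear.Build F 'rV[F]_t 'rV[F]_(2 * t) _ encode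
  encode_is_linear.

Definition code : {vspace 'rV[F]_(2 * t)} := limg (linfun encode).

Lemma codeP c : reflect (exists r, c = encode r) (c \in code).
Proof.
apply: (iffP memv_imgP) => [[r _ ->]|[r ->]]; exists r; rewrite ?lfunE ?memvf //.
Qed.

Lemma RR_pair_rVpoly (r : 'rV[F]_t) : RR_pair C u v (g + t) ((rVpoly r * (v + h)) %% u) (rVpoly r).
Proof.
split; last by rewrite addKn size_poly.
  rewrite [X in _ - X](divp_eq _ u) opprD addrCA subrr addr0.
  by rewrite -mulNr dvdp_mulIr.
by rewrite -ltnS -u_size ltn_modp u0.
Qed.

Lemma encode_inj : injective encode.
Proof.
move=> r s e; apply: (can_inj rVpolyK); apply/eqP; rewrite -subr_eq0 -raddfB /=.
have /rowP e0 : encode (r - s) = 0 by rewrite linearB /= e subrr.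
have [|j|->//] := @ep_vanish ((rVpoly (r - s) * (v + h)) %% u) (rVpoly (r - s)).
  exact: size_poly.
have /eqP := e0 j; rewrite !mxE mulf_eq0 invr_eq0 (negPf (u_xs j)) orbF.
by move/eqP.
Qed.

Lemma dim_code : \dim code = t.
Proof.
rewrite limg_dim_eq; first by rewrite dimvf; exact: mul1n.
have /eqP -> : lker (linfun encode) == 0%VS.
  by apply/lker0P => r s; rewrite !lfunE; apply: encode_inj.
exact: capv0.
Qed.

Lemma min_dist_code : (0 < t)%N -> (g <= t)%N -> (t - g + 1 <= min_dist code)%N.
Proof.
move=> t0 gt; rewrite /min_dist; elim/big_ind: _ => [|m n hm hn|p].
(* The default value 2t of the minimum also satisfies the bound. *)
- by lia.
- by rewrite leq_min hm hn.
case/and3P => /codeP [r er] /codeP [s es] ne.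
have rs : rVpoly (r - s) != 0.
  rewrite raddf_eq0 ?subr_eq0; last exact: can_inj rVpolyK.
  by apply: contraNneq ne => e; rewrite er es e.
have := card_zeros t0 (RR_pair_rVpoly (r - s)); rewrite rs orbT => /(_ isT).
(* By linearity the distance is the number of nonzeros of one function, at least 2t - (g + t - 1) =
   t - g + 1. *)
set S := [set j | _]; have -> : hamming p.1 p.2 = #|~: S|.
  apply: eq_card => j; rewrite !inE; congr (~~ _).
  have -> : (p.1 0 j == p.2 0 j) = (encode (r - s) 0 j == 0).
    by rewrite linearB /= -er -es !mxE subr_eq0.
  by rewrite mxE mulf_eq0 invr_eq0 (negPf (u_xs j)) orbF.
by have := cardsC S; rewrite card_ord; lia.
Qed.

Variables (K : closedFieldType) (phi : {rmorphism F -> K}).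
Hypothesis smooth : affine_nonsingular (base_change phi C).

Lemma code_is_AG : (0 < t)%N ->
  is_AG_code phi C R (mumford_divisor phi u v - << (Pinf : point K) >>) code.
Proof.
move=> t0 c; have gt : (g < g + t)%N by lia.
have RP := RRspaceP smooth u_size u_dvd gt.
split=> [/codeP [r ->]|[z /RP [a [b [ab ez]]] zc]].
  exists (RR_funfield phi C u ((rVpoly r * (v + h)) %% u) (rVpoly r)).
    by apply/RP; do 2 eexists; split; first exact: RR_pair_rVpoly.
  move=> j; rewrite mxE (ep_affine j); apply: RR_funfield_value => //.
  - exact: ep_R_on.
  - exact: u_xs.
apply/codeP; exists (poly_rV b); apply/rowP => j; rewrite mxE poly_rV_K; last first.
  by have [_ _] := ab; rewrite addKn.
rewrite -(RR_pair_uniq u_size ab); apply: (fmorph_inj phi).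
have := zc j; rewrite (ep_affine j) => V.
apply: (has_value_fun (ep_R_on j) V); rewrite ez.
by apply: RR_funfield_value => //; [apply: ep_R_on|apply: u_xs].
Qed.

End OneCode.
End Code.

(** * The complementary pair *)

Lemma mumford_dvd_eqmod (F : fieldType) g (C : hyperelliptic F g) (u v w : {poly F}) :
  u %| v ^+ 2 + hpol C * v - fpol C -> u %| w - v ->
  u %| w ^+ 2 + hpol C * w - fpol C.
Proof.
move=> uv uw.
have -> : w ^+ 2 + hpol C * w - fpol C =
  (w - v) * (w + v + hpol C) + (v ^+ 2 + hpol C * v - fpol C) by ring.
by apply: dvdp_add; first apply: dvdp_mulr.
Qed.

(* Both codewords come from functions with the same [y]-coefficient [b]. Their
   [x]-parts agree modulo [uA] and at all evaluation points, hence are equal,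
   and then [uB] divides [b (2 vB + h)]. *)
Lemma encode_disjoint (F : finFieldType) g (C : hyperelliptic F g) t
    (R : 'I_(2 * t) -> point F) (X Y : 'I_t -> F) (uA uB vA vB vG vH : {poly F}) r s :
  evaluation_points C R X Y ->
  size uA = g.+1 -> size uB = t.+1 -> coprimep uA uB ->
  coprimep uB (vB *+ 2 + hpol C) ->
  uA %| vG - vA -> uB %| vG - vB -> uA %| vH - vA -> uB %| vH - (- vB - hpol C) ->
  coprimep (uA * uB) (\prod_(i < t) ('X - (X i)%:P)) ->
  encode C R (uA * uB) vG r = encode C R (uA * uB) vH s -> r = 0.
Proof.
move=> EP sA sB cAB cB GA GB HA HB cw e.
have uA0 : uA != 0 by rewrite -size_poly_gt0 sA.
have uB0 : uB != 0 by rewrite -size_poly_gt0 sB.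
have su : size (uA * uB) = (g + t).+1 by rewrite size_mul // sA sB addnS.
have uX i : (uA * uB).[X i] != 0.
  apply/eqP => ua; have : root (uA * uB) (X i) by rewrite rootE ua.
  move/(coprimep_root cw); rewrite (bigD1 i) //= hornerM hornerXsubC subrr mul0r.
  by rewrite eqxx.
have [dG szG _] := RR_pair_rVpoly C vG su r; have [dH szH _] := RR_pair_rVpoly C vH su s.
set a := (_ %% _) in dG szG; set a' := (_ %% _) in dH szH.
have [||b0 wa] := @ep_vanish _ _ _ _ _ _ _ EP (a - a') (rVpoly r - rVpoly s).
- by apply: leq_trans (size_polyD _ _) _; rewrite geq_max size_polyN !size_poly.
- move=> j; have /rowP /(_ j) := e; rewrite !mxE -/a -/a'.
  move/(mulIf (invr_neq0 (u_xs EP uX j))) => ej.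
  rewrite !horner_ringE.
  transitivity (a.[(center (R j)).1] + (rVpoly r).[(center (R j)).1] * (center (R j)).2 -
    (a'.[(center (R j)).1] + (rVpoly s).[(center (R j)).1] * (center (R j)).2)); first by ring.
  by rewrite ej subrr.
have eb := subr0_eq b0; rewrite -eb in dH.
set b := rVpoly r in eb dG dH.
have uAa : uA %| a - a'.
  have -> : a - a' = (a - b * (vG + hpol C)) - (a' - b * (vH + hpol C)) +
     b * ((vG - vA) - (vH - vA)) by ring.
  apply: dvdp_add; last by apply: dvdp_mull; apply: dvdp_sub.
  by apply: dvdp_sub; [apply: dvdp_trans dG|apply: dvdp_trans dH]; apply: dvdp_mulr.
(* [uA] and the product over the abscissas are coprime divisors of a - a', of total degree g + t,
   whereas a - a' has degree below g + t. *)
have aa' : a = a'.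
  apply/eqP; rewrite -subr_eq0; apply: contraT => n0.
  have : uA * \prod_(i < t) ('X - (X i)%:P) %| a - a'.
    by rewrite Gauss_dvdp ?uAa //; move: cw; rewrite coprimepMl => /andP[].
  move/(dvdp_leq n0); rewrite size_mul //; last first.
    by rewrite monic_neq0 // monic_prod_XsubC.
  have -> : \prod_(i < t) ('X - (X i)%:P) = \prod_(i <- enum 'I_t) ('X - (X i)%:P).
    by rewrite big_enum.
  rewrite sA size_prod_XsubC addSn /= size_enum_ord addnS leqNgt ltnS.
  by rewrite (leq_trans (size_polyD _ _)) // geq_max size_polyN szG szH.
have uBb : uB %| b * (vB *+ 2 + hpol C).
  have -> : b * (vB *+ 2 + hpol C) = (a' - b * (vH + hpol C)) - (a - b * (vG + hpol C)) +
    b * ((vH - (- vB - hpol C)) - (vG - vB)) by rewrite aa'; ring.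
  apply: dvdp_add; last by apply: dvdp_mull; apply: dvdp_sub.
  by apply: dvdp_sub; [apply: dvdp_trans dH|apply: dvdp_trans dG]; apply: dvdp_mull.
rewrite Gauss_dvdpl // in uBb.
apply: (can_inj rVpolyK); rewrite linear0 -/b; apply/eqP; apply: contraT => nb.
by have := dvdp_leq nb uBb; rewrite sB ltnNge size_poly.
Qed.

Theorem theorem2
  (F : finFieldType)
  (K : closedFieldType) (phi : {rmorphism F -> K})
  (K_algebraic : forall a : K, algebraicOver phi a)
  (g : nat) (g_ge2 : (2 <= g)%N)
  (C : hyperelliptic F g)
  (C_smooth : affine_nonsingular (base_change phi C))
  (t : nat) (t_ge_g : (g <= t)%N)
  (uA vA uB vB vG vH : {poly F})
  (A_reduced : reduced_mumford C uA vA) (deg_uA : size uA = g.+1)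
  (B_mumford : mumford C uB vB) (deg_uB : size uB = t.+1)
  (uA_uB_coprime : coprimep uA uB)
  (uB_coprime : coprimep uB (vB *+ 2 + hpol C))
  (deg_vG : (size vG <= g + t)%N)
  (vG_A : uA %| vG - vA) (vG_B : uB %| vG - vB)
  (deg_vH : (size vH <= g + t)%N)
  (vH_A : uA %| vH - vA) (vH_B : uB %| vH - (- vB - hpol C))
  (P : 'I_t -> point F) (P_on_curve : forall i, on_curve C (P i))
  (R : 'I_(2 * t) -> point F) (R_distinct : injective R) :
  let G := mumford_divisor phi (uA * uB) vG - << (Pinf : point K) >> in
  let H := mumford_divisor phi (uA * uB) vH - << (Pinf : point K) >> in
  let D := \sum_(j < 2 * t) point_divisor phi (R j) in
  D = \sum_(i < t) (point_divisor phi (P i)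
                    + point_divisor phi (involution C (P i))) ->
  (forall Q : point K, Q \in dom D -> Q \notin dom G /\ Q \notin dom H) ->
  coprimep (uA * uB) (\prod_(i < t) ('X - (xcoord (P i))%:P)) ->
  exists CG CH : {vspace 'rV[F]_(2 * t)},
    [/\ is_AG_code phi C R G CG /\ is_AG_code phi C R H CH,
        LCP CG CH,
        \dim CG = t /\ \dim CH = t
      & (t - g + 1 <= min_dist CG)%N /\ (t - g + 1 <= min_dist CH)%N].
Proof.
move=> G H D eq_D _ cw.
have EP := divisor_evaluation_points P_on_curve R_distinct eq_D.
have t0 : (0 < t)%N by lia.
have /andP[/and3P[_ _ dA] _] := A_reduced; have /and3P[_ _ dB] := B_mumford.
have uA0 : uA != 0 by rewrite -size_poly_gt0 deg_uA.
have uB0 : uB != 0 by rewrite -size_poly_gt0 deg_uB.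
have su : size (uA * uB) = (g + t).+1 by rewrite size_mul // deg_uA deg_uB addnS.
have dG : uA * uB %| vG ^+ 2 + hpol C * vG - fpol C.
  by rewrite Gauss_dvdp // (mumford_dvd_eqmod dA) // (mumford_dvd_eqmod dB).
(* The expression v^2 + h v is invariant under v -> -v - h, so the conjugate of a Mumford pair still
   satisfies the divisibility. *)
have dB' : uB %| (- vB - hpol C) ^+ 2 + hpol C * (- vB - hpol C) - fpol C.
  by move: dB; congr (_ %| _); ring.
have dH : uA * uB %| vH ^+ 2 + hpol C * vH - fpol C.
  by rewrite Gauss_dvdp // (mumford_dvd_eqmod dA) // (mumford_dvd_eqmod dB').
have uX i : (uA * uB).[xcoord (P i)] != 0.
  apply/eqP => ua; have : root (uA * uB) (xcoord (P i)) by rewrite rootE ua.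
  move/(coprimep_root cw); rewrite (bigD1 i) //= hornerM hornerXsubC subrr mul0r.
  by rewrite eqxx.
exists (code C R (uA * uB) vG), (code C R (uA * uB) vH).
have dimG : \dim (code C R (uA * uB) vG) = t by apply: (dim_code EP).
have dimH : \dim (code C R (uA * uB) vH) = t by apply: (dim_code EP).
have cap : (code C R (uA * uB) vG :&: code C R (uA * uB) vH = 0)%VS.
  apply/eqP; rewrite -subv0; apply/subvP => c; rewrite memv_cap => /andP[].
  case/codeP => r -> /codeP [s e]; rewrite memv0.
  have := encode_disjoint EP deg_uA deg_uB uA_uB_coprime uB_coprime vG_A vG_B vH_A vH_B cw e.
  by move=> ->; rewrite linear0.
split=> //.
- by split; apply: (code_is_AG EP).
- split; first exact/directv_addP.
  apply/eqP; rewrite eqEdim subvf dimv_disjoint_sum // dimG dimH dimvf.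
  by rewrite mul2n -addnn; apply: eq_leq; exact: mul1n.
by split; apply: (min_dist_code EP).
Qed.
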